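(* Let $1\le p<n$, $\tau\in[-1,1]$ and let $K$ be a compact set in $\mathbb{R}^n$. Then $$C_{p,\tau}(K)=\inf_{f\in\mathcal{F}(K)}\mathcal{H}_{p,\tau}(f).$$ Moreover, the general $p$-affine capacity is upper-semicontinuous: for any $\varepsilon>0$, there exists an open set $O_\varepsilon$ such that for any compact set $F$ with $K\subset F\subset O_\varepsilon$, $$C_{p,\tau}(F)\le C_{p,\tau}(K)+\varepsilon.$$
   Context: $C_c^\infty$ is the set of smooth functions with compact support in $\mathbb{R}^n$, and $W_0^{1,p}$ is the closure of $C_c^\infty$ under the norm $\|f\|_{1,p}=\|f\|_p+\|\nabla f\|_p$; for $f\in W_0^{1,p}$, $\nabla f$ is the weak gradient. $du$ is the normalized spherical measure on the unit sphere $S^{n-1}$ (total mass $1$). For $\tau\in[-1,1]$ and $t\in\mathbb{R}$ let $\varphi_\tau(t)=\big(\tfrac{1+\tau}{2}\big)^{1/p}t_++\big(\tfrac{1-\tau}{2}\big)^{1/p}t_-$, with $t_+=\max\{t,0\}$ and $t_-=\max\{-t,0\}$. For $f\in W_0^{1,p}$ let $$\mathcal{H}_{p,\tau}(f)=\Big(\int_{S^{n-1}}\Big(\int_{\mathbb{R}^n}[\varphi_\tau(u\cdot\nabla f(x))]^p\,dx\Big)^{-n/p}du\Big)^{-p/n}.$$ For a compact set $K\subset\mathbb{R}^n$ with indicator function $\mathbf{1}_K$, let $$\mathcal{E}(K)=\{f:\ f\in W_0^{1,p},\ f\ge\mathbf{1}_K\},$$ $$\mathcal{F}(K)=\{f:\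 f\in W_0^{1,p},\ 0\le f\le1\text{ in }\mathbb{R}^n,\text{ and } f=1\text{ in a neighborhood of }K\}.$$ The general $p$-affine capacity of a compact set $K$ is defined by $$C_{p,\tau}(K)=\inf_{f\in\mathcal{E}(K)}\mathcal{H}_{p,\tau}(f).$$ *)

(* Defs.v *)
From HB Require Import structures.
From mathcomp Require Import all_boot all_order all_algebra.
From mathcomp Require Import all_classical all_reals all_analysis.
From mathcomp Require Import measurable_realfun.

Set Implicit Arguments.
Unset Strict Implicit.
Unset Printing Implicit Defensive.

Import Order.TTheory GRing.Theory Num.Theory.
Import numFieldNormedType.Exports.

Local Open Scope classical_set_scope.
Local Open Scope ring_scope.

(* Row vectors carry the sigma-algebra generated by the coordinates, exactly as
   the library does for tuples. For T = R, the reals, this is the Borel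
   sigma-algebra of R^n. *)
Definition measure_rV_display : measure_display -> measure_display.
Proof. exact. Qed.

Section measurable_rV.
Context {d} {T : sigmaRingType d}.
Variable n : nat.

Definition coord_rV (i : 'I_n) (x : 'rV[T]_n) : T := x ord0 i.

Let rV_set0 : g_sigma_preimage coord_rV set0.
Proof. exact: sigma_algebra0. Qed.

Let rV_setC A : g_sigma_preimage coord_rV A -> g_sigma_preimage coord_rV (~` A).
Proof. exact: sigma_algebraC. Qed.

Let rV_bigcup (F : _^nat) : (forall i, g_sigma_preimage coord_rV (F i)) ->
  g_sigma_preimage coord_rV (\bigcup_i (F i)).
Proof. exact: sigma_algebra_bigcup. Qed.

HB.instance Definition _ := @isMeasurable.Build (measure_rV_display d)
  'rV[T]_n (g_sigma_preimage coord_rV) rV_set0 rV_setC rV_bigcup.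

End measurable_rV.

Lemma measurable_coord_rV d (T : sigmaRingType d) n (i : 'I_n) :
  measurable_fun [set: 'rV[T]_n] (fun x => x ord0 i).
Proof.
move=> _ Y mY; rewrite setTI; apply: sub_sigma_algebra => /=.
rewrite -bigcup_seq/=; exists i => /=; first by rewrite mem_index_enum.
by exists Y => //; rewrite setTI.
Qed.

Lemma measurable_fun_rV d1 d2 (T1 : measurableType d1) (T2 : measurableType d2)
    n (f : T1 -> 'rV[T2]_n) :
  (forall i, measurable_fun [set: T1] (fun x => f x ord0 i)) ->
  measurable_fun [set: T1] f.
Proof.
move=> mf _ A mA; rewrite setTI.
suff : g_sigma_preimage (@coord_rV _ T2 n) `<=` [set B | measurable (f @^-1` B)].
  by apply.
apply: smallest_sub.
- split => /=.
  + by rewrite preimage_set0.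
  + by move=> B mB; rewrite setTD preimage_setC; exact: measurableC.
  + by move=> F mF; rewrite preimage_bigcup; exact: bigcupT_measurable.
- rewrite -bigcup_seq; apply: bigcup_sub => i _ _ [B mB <-] /=.
  by rewrite setTI; have := mf i measurableT B mB; rewrite setTI.
Qed.

Section lebesgue_measure_rV.
Context {R : realType}.

Definition cons_rV n (xv : R * 'rV[R]_n) : 'rV[R]_n.+1 :=
  row_mx (const_mx xv.1 : 'rV_1) xv.2.

Lemma measurable_cons_rV n : measurable_fun setT (@cons_rV n).
Proof.
apply: measurable_fun_rV => i; rewrite /cons_rV.
have [j|j] := splitP (i : 'I_(1 + n)) => ij.
  rewrite (_ : (fun _ => _) = fst); first exact: measurable_fst.
  apply/funext => x; rewrite (_ : i = lshift n j :> 'I_(1 + n)); last exact: val_inj.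
  by rewrite (@row_mxEl _ 1 1 n) mxE.
rewrite (_ : (fun _ => _) = (fun v : 'rV[R]_n => v ord0 j) \o snd).
  by apply: measurableT_comp; [exact: measurable_coord_rV|exact: measurable_snd].
apply/funext => x; rewrite (_ : i = rshift 1 j :> 'I_(1 + n)); last exact: val_inj.
by rewrite (@row_mxEr _ 1 1 n).
Qed.

Let uncons_rV n (v : 'rV[R]_n.+1) : R * 'rV[R]_n :=
  (v ord0 ord0, \row_j v ord0 (lift ord0 j)).

Let measurable_uncons_rV n : measurable_fun setT (@uncons_rV n).
Proof.
apply: measurable_fun_pair; first exact: measurable_coord_rV.
apply: measurable_fun_rV => i.
rewrite (_ : (fun _ => _) = (fun v : 'rV[R]_n.+1 => v ord0 (lift ord0 i))).
  exact: measurable_coord_rV.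
by apply/funext => v; rewrite mxE.
Qed.

Let cons_rVK n : cancel (@cons_rV n) (@uncons_rV n).
Proof.
move=> [x v]; rewrite /uncons_rV /cons_rV/=; congr pair.
  rewrite (_ : ord0 = lshift n ord0 :> 'I_(1 + n)); last exact: val_inj.
  by rewrite (@row_mxEl _ 1 1 n) mxE.
apply/rowP => j; rewrite mxE.
rewrite (_ : lift ord0 j = rshift 1 j :> 'I_(1 + n)); last exact: val_inj.
by rewrite (@row_mxEr _ 1 1 n).
Qed.

(* Image of the product of the one-dimensional Lebesgue measure and m under
   R * R^n -> R^(n+1). *)
Definition lebesgue_cons n
    (m : {sigma_finite_measure set 'rV[R]_n -> \bar R}) :
    set 'rV[R]_n.+1 -> \bar R :=
  pushforward (lebesgue_measure \x m)%E (@cons_rV n).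

Section instances.
Variables (n : nat) (m : {sigma_finite_measure set 'rV[R]_n -> \bar R}).

HB.instance Definition _ := Measure.copy (lebesgue_cons m)
  (measure_function_pushforward__canonical__measure_function_Measure
    (lebesgue_measure \x m)%E (@measurable_cons_rV n)).

Let sigma_finite_lebesgue_cons : sigma_finite setT (lebesgue_cons m).
Proof.
have /sigma_finiteP[F [TF ndF Foo]] := sigma_finiteT (@lebesgue_measure R).
have /sigma_finiteP[G [TG ndG Goo]] := sigma_finiteT m.
exists (fun k => @uncons_rV n @^-1` (F k `*` G k)).
  apply/seteqP; split => // v _.
  have [i _ Fi] : (\bigcup_i F i) (v ord0 ord0) by rewrite -TF.
  have [j _ Gj] : (\bigcup_i G i) (uncons_rV v).2 by rewrite -TG.
  exists (maxn i j) => //; split.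
    by move: Fi; exact/subsetPset/ndF/leq_maxl.
  by move: Gj; exact/subsetPset/ndG/leq_maxr.
move=> k; have [mF Fk] := Foo k; have [mG Gk] := Goo k; split.
  have mFG : measurable (F k `*` G k) by exact: measurableX.
  by have := measurable_uncons_rV measurableT mFG; rewrite setTI.
rewrite /lebesgue_cons /pushforward -comp_preimage.
rewrite (_ : _ \o _ = id); last by apply/funext => v /=; exact: cons_rVK.
by rewrite preimage_id product_measure1E// lte_mul_pinfty// ge0_fin_numE.
Qed.

HB.instance Definition _ := Measure_isSigmaFinite.Build _ _ _ (lebesgue_cons m)
  sigma_finite_lebesgue_cons.

End instances.

Fixpoint lebesgue_rV n : {sigma_finite_measure set 'rV[R]_n -> \bar R} :=
  match n with
  | 0 => \d_(0 : 'rV[R]_0)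
  | n.+1 => lebesgue_cons (lebesgue_rV n)
  end.

Lemma lebesgue_rV_box n (A : 'I_n -> set R) : (forall i, measurable (A i)) ->
  lebesgue_rV n [set x | forall i, A i (x ord0 i)] =
  (\prod_(i < n) lebesgue_measure (A i))%E.
Proof.
elim: n A => [|n IH] A mA.
  rewrite big_ord0 /= diracE mem_set//; by case.
have mB : measurable [set v : 'rV[R]_n |
    forall i, A (lift ord0 i) (v ord0 i)].
  rewrite (_ : mkset _ = \bigcap_(i in [set: 'I_n])
      (fun x : 'rV[R]_n => x ord0 i) @^-1` (A (lift ord0 i))).
    apply: fin_bigcap_measurable => // i _.
    rewrite -[X in measurable X]setTI.
    exact: (measurable_coord_rV i measurableT (mA (lift ord0 i))).
  by apply/seteqP; split => [x Ax i _|x Ax i]; exact: Ax.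
rewrite big_ord_recl -(IH (fun i => A (lift ord0 i)))//.
transitivity ((lebesgue_measure \x lebesgue_rV n)%E (A ord0 `*`
    [set v : 'rV[R]_n | forall i, A (lift ord0 i) (v ord0 i)])); last first.
  exact: (@product_measure1E _ _ _ _ R lebesgue_measure (lebesgue_rV n) _ _
    (mA ord0) mB).
apply: (congr1 (lebesgue_measure \x lebesgue_rV n)%E).
apply/seteqP; split => [xv /= Axv|xv /= [Ax Av] i].
  have := cons_rVK xv; rewrite /uncons_rV.
  move=> /[dup] /(congr1 fst)/= <- /(congr1 snd)/= <-.
  by split => // i; rewrite mxE; exact: Axv.
have := cons_rVK xv; rewrite /uncons_rV.
have [j ->|->] := unliftP ord0 i.
  by move=> /(congr1 snd)/= /rowP/(_ j); rewrite mxE => ->.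
by move=> /(congr1 fst)/= ->.
Qed.

End lebesgue_measure_rV.

Section euclidean.
Context {R : realType} {n : nat}.
Implicit Types x y u : 'rV[R]_n.

Definition dotp x y : R := \sum_(i < n) x ord0 i * y ord0 i.

(* The norm `|x| of the library on 'rV[R]_n is the sup norm. *)
Definition enorm x : R := Num.sqrt (dotp x x).

Definition eball x (r : R) : set 'rV[R]_n := [set y | enorm (y - x) < r].

Definition sphere : set 'rV[R]_n := [set u | enorm u = 1].

Lemma enorm_ge0 x : 0 <= enorm x. Proof. exact: sqrtr_ge0. Qed.

Lemma measurable_enorm : measurable_fun setT enorm.
Proof.
rewrite (_ : enorm = (fun x => dotp x x `^ 2^-1)); last first.
  apply/funext => x; rewrite powR12_sqrt//.
  by apply: sumr_ge0 => i _; rewrite -expr2 sqr_ge0.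
apply: (@measurableT_comp _ _ _ _ _ _ (@powR R ^~ 2^-1)) => //.
by apply: measurable_sum => i; apply: measurable_funM;
  exact: measurable_coord_rV.
Qed.

Definition normalize x : 'rV[R]_n := (enorm x)^-1 *: x.

Lemma measurable_normalize : measurable_fun setT normalize.
Proof.
apply: measurable_fun_rV => i.
rewrite (_ : (fun x => _) = (fun x => enorm x `^ (-1) * x ord0 i)); last first.
  by apply/funext => x; rewrite powR_inv1 ?enorm_ge0// mxE.
apply: measurable_funM; last exact: measurable_coord_rV.
apply: (@measurableT_comp _ _ _ _ _ _ (@powR R ^~ (-1))) => //.
exact: measurable_enorm.
Qed.

Lemma measurable_unit_ball : measurable (eball 0 1).
Proof.
rewrite (_ : eball 0 1 = enorm @^-1` `]-oo, 1[).
  rewrite -[X in measurable X]setTI.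
  exact: (measurable_enorm measurableT (measurable_itv _)).
by apply/seteqP; split => x; rewrite /eball /= subr0 in_itv.
Qed.

(* Polar coordinates: the (unnormalized) surface measure of a part A of the
   sphere is n times the volume of the cone {r u | 0 < r < 1, u in A}, so the
   normalized one is the volume of this cone divided by that of the ball. *)
Definition cone_volume : set 'rV[R]_n -> \bar R :=
  pushforward (mrestr (@lebesgue_rV R n) measurable_unit_ball) normalize.

HB.instance Definition _ := Measure.copy cone_volume
  (measure_function_pushforward__canonical__measure_function_Measure
    (mrestr (@lebesgue_rV R n) measurable_unit_ball) measurable_normalize).

Lemma inv_unit_ball_volume_ge0 :
  0 <= (fine (lebesgue_rV n (eball 0 1)))^-1 :> R.
Proof. by rewrite invr_ge0 fine_ge0. Qed.

Definition sphere_measure : {measure set 'rV[R]_n -> \bar R} :=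
  mscale (NngNum inv_unit_ball_volume_ge0) cone_volume.

End euclidean.

Section sobolev.
Context {R : realType} {n : nat}.
Implicit Types (f phi : 'rV[R]_n -> R) (g : 'rV[R]_n -> 'rV[R]_n) (p tau : R).
Implicit Types (K : set 'rV[R]_n).

Local Notation mu := (@lebesgue_rV R n).
Local Notation e_ i := (delta_mx ord0 i : 'rV[R]_n).

Definition iter_partial (s : seq 'I_n) f : 'rV[R]_n -> R :=
  foldr (fun i h => 'D_(e_ i) h) f s.

Definition smooth f := forall s, continuous (iter_partial s f) /\
  forall i x, derivable (iter_partial s f) x (e_ i).

Definition Cc_infty : set ('rV[R]_n -> R) :=
  [set phi | smooth phi /\ compact (closure [set x | phi x != 0])].

Definition locally_integrable_rV f := measurable_fun setT f /\
  forall C, compact C -> mu.-integrable C (EFin \o f).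

Definition is_weak_gradient f g := [/\ locally_integrable_rV f,
  forall i, locally_integrable_rV (fun x => g x ord0 i) &
  forall phi i, Cc_infty phi ->
    \int[mu]_x (f x * 'D_(e_ i) phi x) = - \int[mu]_x (g x ord0 i * phi x)].

(* A weak gradient is unique up to a null set; one is chosen (0 if none). *)
Definition weak_gradient f : 'rV[R]_n -> 'rV[R]_n :=
  xget (fun=> 0) [set g | is_weak_gradient f g].

Local Open Scope ereal_scope.

Definition sobolev_norm p f : \bar R :=
  'N[mu]_p%:E[EFin \o f] + 'N[mu]_p%:E[EFin \o (enorm \o weak_gradient f)].

Definition sobolev p : set ('rV[R]_n -> R) :=
  [set f | [/\ measurable_fun setT f, exists g, is_weak_gradient f g &
               sobolev_norm p f < +oo]].

(* The elements of W_0^{1,p} are functions and not classes modulo null sets;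
   everything below depends on the class only. *)
Definition sobolev0 p : set ('rV[R]_n -> R) :=
  [set f | sobolev p f /\ forall eps : R, (0 < eps)%R ->
     exists2 phi, Cc_infty phi & sobolev_norm p (f \- phi)%R < eps%:E].

(* The precise representative of (the class of) f. *)
Definition ball_average f x (r : R) : R :=
  ((fine (mu (eball x r)))^-1 * \int[mu]_(y in eball x r) f y)%R.

Definition precise f x : R :=
  let F := ball_average f x r @[r --> 0^'+] in
  if `[< cvg F >] then lim F else 0%R.

Definition varphi p tau (t : R) : R :=
  (((1 + tau) / 2) `^ p^-1 * Num.max t 0 +
   ((1 - tau) / 2) `^ p^-1 * Num.max (- t) 0)%R.

(* The negative powers are written as inverses since in \bar R the inverse of 0
   is +oo, whereas 0 `^ r = 0 for all r != 0. *)
Definition energy p tau f : \bar R :=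
  ((\int[sphere_measure]_(u in sphere)
      ((\int[mu]_x (varphi p tau (dotp u (weak_gradient f x)) `^ p)%:E)
         `^ (n%:R / p))^-1) `^ (p / n%:R))^-1.

(* Pointwise conditions on an element of W_0^{1,p} refer to its precise
   representative. An inequality f >= 1_K that ignores null sets would give
   capacity 0 to every null compact set, e.g. to the unit sphere. *)
Definition calE p K : set ('rV[R]_n -> R) :=
  [set f | sobolev0 p f /\ forall x, (\1_K x <= precise f x)%R].

Definition calF p K : set ('rV[R]_n -> R) :=
  [set f | [/\ sobolev0 p f, forall x, (0 <= precise f x <= 1)%R &
     exists U, [/\ open U, K `<=` U & forall x, U x -> precise f x = 1%R]]].

Definition capacity p tau K : \bar R :=
  ereal_inf [set energy p tau f | f in calE p K].

End sobolev.

(* Main.v *)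
(** Given [f] in E(K), ball averages of [f] on a shrinking sequence of radii
converge to a limit that is at least 1 at every point of K. Replacing [f] by test
functions close to it in W^{1,p}, and the averages by Riemann sums, yields finite
convex combinations [v_k] of translates of test functions; they converge to the
precise representative of [f] on K, and by Minkowski's inequality and translation
invariance the seminorms [N_u(v) = ||varphi_tau (u . grad v)||_p] are at most
[N_u(f) + e]. Composing with a smooth ramp [T] of slope at most [1 + e] gives test
functions [T(v_k)] with values in [0, 1] that tend to 1 pointwise on K. By an
elementary form of Mazur's lemma (Simons' inequality), convex combinations of the
[T(v_k)] are uniformly close to 1 on the compact K; one more composition with [T]
gives a test function in F(K). Its energy is controlled by that of [f] through the
monotone convergence theorem on the sphere. Upper semicontinuity is then immediate:
an element of F(K) that is 1 on a neighborhood U of K belongs to E(F) whenever F is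
contained in U. In particular no capacitary quasi-continuity is needed, and p = 1 is
not a special case. *)

Require Import Defs.
From mathcomp Require Import all_boot all_order all_algebra.
From mathcomp Require Import all_classical all_reals all_analysis.
From mathcomp Require Import measurable_realfun.
From mathcomp Require Import ring lra.
Import Order.TTheory GRing.Theory Num.Theory.
Import numFieldNormedType.Exports.
Set Implicit Arguments.
Unset Strict Implicit.
Unset Printing Implicit Defensive.
Local Open Scope classical_set_scope.
Local Open Scope ring_scope.

(** * Simons' inequality *)

(** Convexity is exploited for each N_u separately and not for the energy, a negative-power mean
    over u: a family of bounds N_u <= b(u), imposed for all u at once, cuts out a convex set of test
    functions. For tau <> 0 the integrand [varphi] is only positively homogeneous, so functions
    composed on the left have to be nondecreasing. The averages of f converge at a rate that depends
    on the point of K, which is why pointwise convergence has to be upgraded by convex combinations.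
    The ramp applied before this step provides the common bounds 0 and 1 that Simons' inequality
    requires; the ramp applied after it turns almost 1 on K into exactly 1 near K. Errors take the
    form (1 + e)(N_u(f) + e): the summand e keeps the bound positive in directions with N_u(f) = 0,
    and the expression decreases to N_u(f) with e, so its negative powers increase, as monotone
    convergence demands. *)

Definition convex_fset {R : realType} {T : Type} (C : set (T -> R)) :=
  forall f g t, C f -> C g -> 0 <= t <= 1 ->
    C (fun x => t * f x + (1 - t) * g x).

Section simons.
Context {R : realType} {T : topologicalType}.
Variables (K : set T) (C : nat -> set (T -> R)) (eps : R).
Hypothesis cK : compact K.
Hypothesis convC : forall n, convex_fset (C n).
Hypothesis decC : forall n, C n.+1 `<=` C n.
Hypothesis C0 : forall n, C n !=set0.
Hypothesis contC : forall n f, C n f -> continuous f.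
Hypothesis C01 : forall n f x, C n f -> 0 <= f x <= 1.
Hypothesis C_to0 : forall x e, K x -> 0 < e ->
  exists n, forall f, C n f -> f x <= e.
Hypothesis eps0 : 0 < eps.

Local Notation h n := ((2^-1 : R) ^+ n).

Let s (F : T -> R) := sup [set F x | x in K].

Let decCn n m : C (n + m)%N `<=` C n.
Proof.
elim: m => [|m IH]; first by rewrite addn0.
by rewrite addnS => f /decC /IH.
Qed.

Let h_gt0 n : 0 < h n. Proof. by rewrite exprn_gt0. Qed.
Let hS n : h n.+1 = h n / 2. Proof. by rewrite exprS mulrC. Qed.
Let h_le1 n : h n <= 1. Proof. by rewrite exprn_ile1//; lra. Qed.

Let h_small (e : R) : 0 < e -> exists n, h n < e.
Proof.
move=> e0; have : (GRing.exp (2^-1 : R)) x @[x --> \oo] --> 0.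
  by apply: cvg_expr; rewrite ger0_norm//; lra.
move=> /cvgrPdist_lt/(_ _ e0)[n _ /(_ n (leqnn n))] /=.
by rewrite sub0r normrN ger0_norm ?(ltW (h_gt0 n))//; exists n.
Qed.

Let s_ub F M x : (forall x, F x <= M) -> K x -> F x <= s F.
Proof.
by move=> FM Kx; apply: ub_le_sup; [exists M => _ [y _ <-]|exists x].
Qed.

Let s_le F M : K !=set0 -> (forall x, K x -> F x <= M) -> s F <= M.
Proof. by move=> [x Kx] FM; apply: ge_sup => [|_ [y Ky <-]]; [exists (F x); exists x|exact: FM]. Qed.

(* The series [g_0 + g_1 / 2 + g_2 / 4 + ...], with [g_n] in [C n], is built greedily:
   each partial sum [G] has an almost minimal supremum over K. If every element of
   [C 0] exceeded [eps] somewhere on K, the suprema of the partial sums would stay so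
   far below that of the series that, at a maximum point of the series, the tails
   could not tend to 0 relative to their weights. *)
Let near_min F n (d : R) : K !=set0 -> (forall x, 0 <= F x) ->
  (forall x, F x <= 2) -> 0 < d ->
  exists2 g, C n g & forall g', C n g' ->
    s (fun x => F x + h n * g x) <= s (fun x => F x + h n * g' x) + d.
Proof.
move=> K0 F0 F2 d0.
pose A := [set s (fun x => F x + h n * g x) | g in C n].
have A0 : A !=set0 by have [g Cg] := C0 n; exists (s (fun x => F x + h n * g x)); exists g.
have lbA : has_lbound A.
  exists 0 => _ [g Cg <-]; have [x Kx] := K0.
  apply: (@le_trans _ _ (F x + h n * g x)).
    by rewrite addr_ge0// mulr_ge0// ?(ltW (h_gt0 _))//; have /andP[] := C01 x Cg.
  apply: (@s_ub _ 3) => // y; have := F2 y; have /andP[] := C01 y Cg.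
  by have := h_le1 n; have := h_gt0 n; nra.
have [_ [g Cg <-] gA] := inf_adherent d0 (conj A0 lbA).
exists g => // g' Cg'; rewrite (le_trans (ltW gA))// lerD2r.
by apply: ge_inf => //; exists g'.
Qed.

Let noconv := forall f, C 0 f -> exists2 x, K x & eps < f x.

(** The tolerance is of the order of the square of the weight [h n], small enough to be paid for by
    the second-order term of the invariant [gap]. *)
Let nxt (F : T -> R) n : T -> R :=
  xget (fun=> 0) [set g | C n g /\ forall g', C n g' ->
    s (fun x => F x + h n * g x) <= s (fun x => F x + h n * g' x)
       + eps / 16 * (h n * h n)].

Let Fixpoint G n : T -> R :=
  if n is m.+1 then fun x => G m x + h m * nxt (G m) m x else fun=> 0.

Let g n := nxt (G n) n.

Let GS n x : G n.+1 x = G n x + h n * g n x. Proof. by []. Qed.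

Let K0 : noconv -> K !=set0.
Proof. by move=> nc; have [f /nc[x Kx _]] := C0 0; exists x. Qed.

Let G_bounds : noconv -> forall n, (forall x, 0 <= G n x <= 2 - 2 * h n) /\ C n (g n) /\
   forall g', C n g' ->
    s (G n.+1) <= s (fun x => G n x + h n * g' x) + eps / 16 * (h n * h n).
Proof.
move=> nc; have step n : (forall x, 0 <= G n x <= 2 - 2 * h n) ->
    C n (g n) /\ forall g', C n g' ->
    s (G n.+1) <= s (fun x => G n x + h n * g' x) + eps / 16 * (h n * h n).
  move=> Gn; apply: (@xgetPex _ (fun=> 0) [set g | C n g /\ forall g', C n g' ->
    s (fun x => G n x + h n * g x) <= s (fun x => G n x + h n * g' x)
       + eps / 16 * (h n * h n)]).
  have e0 : 0 < eps / 16 * (h n * h n) by rewrite mulr_gt0 ?divr_gt0// mulr_gt0.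
  have [||g' Cg sg] := @near_min (G n) n _ (K0 nc) _ _ e0; last by exists g'.
  - by move=> x; have /andP[] := Gn x.
  - by move=> x; have /andP[_] := Gn x; have := h_gt0 n; lra.
elim=> [|n [Gn [Cg _]]].
  have G0 x : 0 <= G 0 x <= 2 - 2 * h 0 by rewrite expr0 mulr1 subrr lexx.
  by split=> //; exact: step.
have G0 x : 0 <= G n.+1 x <= 2 - 2 * h n.+1.
  rewrite GS hS; have := Gn x; have := C01 x Cg; have := h_gt0 n.
  set a := h n; set b := g n x; set c := G n x => a0 /andP[b0 b1] /andP[c0 c1].
  by apply/andP; split; nra.
by split=> //; exact: step.
Qed.

(** The terms of index [n] to [n + m] add up to their total weight times a convex combination of
    [g n], ..., [g (n + m)], all of which lie in [C n] because the sets decrease. *)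
Let tail : noconv -> forall n m, exists2 f, C n f &
  forall x, G (n + m.+1) x = G n x + h n * (2 - 2 * h m.+1) * f x.
Proof.
move=> nc n m; elim: m => [|m [f Cf IH]].
  exists (g n); first by have [_ []] := G_bounds nc n.
  by move=> x; rewrite addn1 GS expr1; congr (_ + _); field.
pose w := 2 - 2 * h m.+1; pose t := w / (w + h m.+1).
have w0 : 0 <= w by have := h_le1 m.+1; rewrite /w; lra.
have hm := h_gt0 m.+1.
exists (fun x => t * f x + (1 - t) * g (n + m.+1)%N x).
  apply: convC => //.
    by apply: (@decCn n m.+1); have [_ []] := G_bounds nc (n + m.+1).
  have wh : 0 < w + h m.+1 by exact: ltr_wpDl.
  by rewrite /t divr_ge0 ?(ltW wh)//= ler_pdivrMr// mul1r lerDl ltW.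
move=> x; rewrite addnS GS IH exprD (hS m.+1) -/w.
have -> : 2 - 2 * (h m.+1 / 2) = w + h m.+1 by rewrite /w; field.
rewrite -addrA; congr (_ + _); rewrite /t; field; lra.
Qed.

(** Stands for the supremum over K of the whole series; no infinite sum has to be formed. *)
Let S := sup [set s (G n) | n in setT].

Let sG_le2 : noconv -> forall n, s (G n) <= 2.
Proof.
move=> nc n; apply: s_le => [|x Kx]; first exact: K0.
by have [/(_ x)/andP[_]] := G_bounds nc n; have := h_gt0 n; lra.
Qed.

Let sG_leS : noconv -> forall n, s (G n) <= S.
Proof.
by move=> nc n; apply: ub_le_sup; [exists 2 => _ [k _ <-]; exact: sG_le2|exists n].
Qed.

Let S_le2 : noconv -> S <= 2.
Proof. by move=> nc; apply: ge_sup => [|_ [n _ <-]]; [exists (s (G 0)); exists 0|exact: sG_le2]. Qed.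

Let G_le_s : noconv -> forall n x, K x -> G n x <= s (G n).
Proof.
move=> nc n x Kx; apply: (@s_ub _ 2) => // y.
by have [/(_ y)/andP[_]] := G_bounds nc n; have := h_gt0 n; lra.
Qed.

Let S_sG : noconv -> forall n, S <= s (G n) + 2 * h n.
Proof.
move=> nc n; apply: ge_sup; first by exists (s (G 0)); exists 0.
move=> _ [m _ <-]; apply: s_le => [|x Kx]; first exact: K0.
have Gs := @G_le_s nc n x Kx.
have [nm|mn] := ltnP n m; last first.
  have mono k : G m x <= G (m + k) x.
    elim: k => [|k IH]; first by rewrite addn0.
    rewrite addnS GS (le_trans IH)// lerDl mulr_ge0 ?(ltW (h_gt0 _))//.
    by have [_ [/(C01 x)/andP[]]] := G_bounds nc (m + k).
  by have := mono (n - m)%N; rewrite subnKC//; have := h_gt0 n; lra.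
have [f Cf] := tail nc n (m - n.+1); rewrite -addSnnS subnKC// => ->.
have := C01 x Cf; set b := h (m - n.+1).+1.
have : 0 < b by exact: h_gt0.
have := h_gt0 n; set a := h n => a0 b0 /andP[f0 f1].
rewrite lerD// mulrAC.
have : a * f x <= a by nra.
have : 0 <= a * f x by nra.
by nra.
Qed.

(** Being almost optimal, [g n] does hardly worse than the normalized block [f] of [tail]. With [f]
    the sum is [(1 - c) * G n + c * G (n + M.+1)], where [c] tends to 1/2 as the block grows. Half
    of the error [eps / 8] is the tolerance of [nxt], the other half comes from the excess of [c]
    over 1/2. *)
Let sG_step : noconv -> forall n,
  s (G n.+1) <= s (G n) / 2 + S / 2 + eps / 8 * (h n * h n).
Proof.
move=> nc n; have e0 : 0 < eps / 32 * (h n * h n).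
  by rewrite mulr_gt0 ?divr_gt0// mulr_gt0.
have [M hM] := h_small e0.
have [f Cf fG] := tail nc n M.
have [_ [_ /(_ _ Cf) sGf]] := G_bounds nc n.
pose c := (2 - 2 * h M.+1)^-1.
have hM0 := h_gt0 M.
have hM1 : h M.+1 <= 2^-1 by rewrite hS; have := h_le1 M; lra.
have c0 : 0 < c by rewrite invr_gt0; lra.
have c1 : c <= 1 by rewrite invf_le1; lra.
have ch : c <= 2^-1 + h M.
  rewrite /c -[leLHS]mul1r ler_pdivrMr; last lra.
  rewrite hS in hM1 *; have := h_le1 M; nra.
suff : s (fun x => G n x + h n * f x) <= (1 - c) * s (G n) + c * S.
  move=> H; rewrite (le_trans sGf)//.
  have SG := @sG_leS nc n; have S2 := S_le2 nc.
  have sG0 : 0 <= s (G n).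
    have [x Kx] := K0 nc; rewrite (le_trans _ (@G_le_s nc n x Kx))//.
    by have [/(_ x)/andP[]] := G_bounds nc n.
  have : (c - 2^-1) * (S - s (G n)) <= h M * 2.
    apply: (@le_trans _ _ (h M * (S - s (G n)))).
      by apply: ler_wpM2r; lra.
    by apply: ler_wpM2l; lra.
  lra.
apply: s_le => [|x Kx]; first exact: K0.
have -> : G n x + h n * f x = (1 - c) * G n x + c * G (n + M.+1) x.
  by rewrite fG /c; field; lra.
rewrite lerD// ler_wpM2l//; [lra|exact: G_le_s|exact: ltW|].
by rewrite (le_trans (@G_le_s nc _ x Kx))//; exact: sG_leS.
Qed.

(** The second-order term is tuned to the induction: halving leaves [eps / 4 * h n * h n] of it,
    [sG_step] consumes [eps / 8 * h n * h n], and the rest is exactly what [n.+1] requires. *)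
Let gap : noconv -> forall n, h n * (eps / 2 + eps / 2 * h n) <= S - s (G n).
Proof.
move=> nc; elim => [|n IH].
  rewrite expr0.
  have -> : s (G 0) = 0.
    have [x Kx] := K0 nc; rewrite /s (_ : image _ _ = [set 0]) ?sup1//.
    by apply/seteqP; split => [_ [y _ <-]//|_ ->]; exists x.
  have [_ [/nc[x Kx egx] _]] := G_bounds nc 0.
  have := @G_le_s nc 1 x Kx; have := @sG_leS nc 1; rewrite GS expr0 /=.
  lra.
have := sG_step nc n; rewrite hS; have := h_gt0 n; nra.
Qed.

Lemma convex_seq_small : exists2 f, C 0 f & forall x, K x -> f x <= eps.
Proof.
apply: contrapT => Hn.
have nc : noconv.
  move=> f Cf; apply: contrapT => Hf; apply: Hn; exists f => // x Kx.
  by rewrite leNgt; apply/negP => ?; apply: Hf; exists x.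
have cG n : continuous (G n).
  elim: n => [|n IH]; first exact: cst_continuous.
  have [_ [/contC cg _]] := G_bounds nc n.
  move=> x; apply: (@continuousD _ R^o _ (G n) (fun x => h n * g n x)); first exact: IH.
  by apply: (@continuousM _ _ (cst (h n)) (g n)); [exact: cvg_cst|exact: cg].
(* The constant 4 makes these sets nonempty on K by [S_sG], and decreasing because
   [4 * h n.+1 + h n <= 4 * h n]. A cluster point of points chosen in them then belongs to all of
   them. *)
pose Kn n := [set x | S - 4 * h n <= G n x].
have KnS n : Kn n.+1 `<=` Kn n.
  move=> x; change (S - 4 * h n.+1 <= G n.+1 x -> S - 4 * h n <= G n x).
  rewrite GS hS; have [_ [/(C01 x)/andP[_ g1] _]] := G_bounds nc n.
  have := h_gt0 n; nra.
have KnD n m : Kn (n + m)%N `<=` Kn n.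
  by elim: m => [|m IH]; [rewrite addn0|rewrite addnS => x /KnS/IH].
have /choice[xs Hxs] n : exists x, K x /\ Kn n x.
  have [||_ [x Kx <-] sx] := @sup_gt _ [set G n x | x in K] (S - 4 * h n).
  - by have [x Kx] := K0 nc; exists (G n x); exists x.
  - by have := S_sG nc n; have := h_gt0 n; rewrite /s; lra.
  - by exists x; split => //; exact: ltW.
have [p [Kp clp]] : K `&` cluster (xs @ \oo) !=set0.
  by apply: cK; exists 0%N => // n _; have [] := Hxs n.
have Knp n : Kn n p.
  have clo : closed (Kn n).
    rewrite (_ : Kn n = G n @^-1` [set y | S - 4 * h n <= y])//.
    by apply: closed_comp => [x _|]; [exact: cG|exact: closed_ge].
  apply: clo => B Bp; apply: clp => //.
  by exists n => // m /= nm; have [_] := Hxs m; rewrite -(subnKC nm) => /KnD.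
(* At [p] the block after [G n] contributes at most [2 * h n * (eps / 8)], yet it lifts the sum
   almost to [S]; so [S - s (G n)] would be smaller than [gap] allows. *)
have [|n Hn'] := @C_to0 p (eps / 8) Kp; first by rewrite divr_gt0.
have [|M HM] := @h_small (eps / 32); first by rewrite divr_gt0.
have [f Cf fG] := tail nc n M.
have : S - 4 * h (n + M.+1) <= G (n + M.+1) p by exact: Knp.
rewrite fG.
have := Hn' _ Cf; have := C01 p Cf; have := @G_le_s nc n p Kp; have := gap nc n.
have := h_gt0 n; have := h_gt0 M; rewrite exprD hS.
set a := h n; set b := h M in HM *; set u := f p; set v := G n p; set w := s _.
move=> b0 a0 H1 H2 /andP[u0 _] u1 H3.
have : a * (2 - 2 * (b / 2)) * u <= a * (eps / 4).
  rewrite -mulrA ler_pM2l//; nra.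
nra.
Qed.

End simons.

(** * Lebesgue measure on R^n *)

Section rV_measure.
Context {R : realType} {n : nat}.
Implicit Types (a b x y : 'rV[R]_n).
Local Notation mu := (@lebesgue_rV R n).
Local Notation V := 'rV[R]_n.

(** Half-open intervals match the generators of the Borel sets of the line and are stable under
    intersection. *)
Definition box a b : set V := [set x | forall i, `]a ord0 i, b ord0 i]%classic (x ord0 i)].

Definition boxes : set (set V) := [set box ab.1 ab.2 | ab in [set: V * V]].

Lemma box_boxes a b : boxes (box a b). Proof. by exists (a, b). Qed.

Lemma measurable_coords (A : 'I_n -> set R) : (forall i, measurable (A i)) ->
  measurable [set x : V | forall i, A i (x ord0 i)].
Proof.
move=> mA; rewrite (_ : mkset _ = \bigcap_(i in [set: 'I_n])
    (fun x : V => x ord0 i) @^-1` (A i)).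
  apply: fin_bigcap_measurable => // i _; rewrite -[X in measurable X]setTI.
  exact: (measurable_coord_rV i measurableT (mA i)).
by apply/seteqP; split => [x Ax i _|x Ax i]; exact: Ax.
Qed.

Lemma measurable_box a b : measurable (box a b).
Proof. by apply: (measurable_coords (A := fun i => `]a ord0 i, b ord0 i]%classic)). Qed.

Lemma boxes_setI : setI_closed boxes.
Proof.
move=> _ _ [[a b] _ <-] [[c d] _ <-] /=.
exists (\row_i Num.max (a ord0 i) (c ord0 i), \row_i Num.min (b ord0 i) (d ord0 i)) => //.
apply/seteqP; split => x /=.
  move=> H; split => i; have := H i; rewrite !mxE /= !in_itv /= gt_max le_min;
    by move=> /andP[/andP[? ?] /andP[? ?]]; apply/andP.
move=> [H1 H2] i; have := H1 i; have := H2 i; rewrite !mxE /= !in_itv /= gt_max le_min.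
by move=> /andP[-> ->] /andP[-> ->].
Qed.

Definition cube (k : nat) : set V := box (const_mx (- k%:R)) (const_mx k%:R).

Lemma cubeP k x : `|x| < k%:R -> cube k x.
Proof.
move=> xk i; rewrite !mxE /= in_itv /=.
have : `|x ord0 i| < k%:R.
  by apply: le_lt_trans xk; rewrite [leRHS]mx_normrE (le_bigmax _ _ (ord0, i)).
by rewrite ltr_norml => /andP[-> /ltW ->].
Qed.

Lemma bigcup_cube : \bigcup_k cube k = setT.
Proof.
apply/seteqP; split => // x _.
exists (Num.truncn `|x|).+1 => //.
by apply: cubeP; exact: truncnS_gt.
Qed.

(** The preimage of an interval under one coordinate is the countable union of the boxes obtained by
    confining the other coordinates to the cubes. *)
Lemma measurable_boxes : measurable = <<s boxes >>.
Proof.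
apply/seteqP; split; last first.
  apply: smallest_sub; first exact: sigma_algebra_measurable.
  by move=> _ [[a b] _ <-]; exact: measurable_box.
apply: smallest_sub; first exact: smallest_sigma_algebra.
rewrite -bigcup_seq; apply: bigcup_sub => i _ _ [B mB <-] /=; rewrite setTI.
suff : (measurable : set (set R)) `<=` [set B | <<s boxes >> ((fun x : V => x ord0 i) @^-1` B)].
  by apply.
apply: smallest_sub.
- split => /=.
  + by rewrite preimage_set0; exact: sigma_algebra0.
  + by move=> A mA; rewrite setTD -preimage_setC -setTD; exact: sigma_algebraCD.
  + by move=> F mF; rewrite preimage_bigcup; exact: sigma_algebra_bigcup.
move=> _ [[c d] _ <-] /=.
rewrite (_ : _ @^-1` _ = \bigcup_k box (\row_j (if j == i then c else - k%:R))
   (\row_j (if j == i then d else k%:R))).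
  by apply: sigma_algebra_bigcup => k; apply: sub_sigma_algebra; exact: box_boxes.
apply/seteqP; split => x /=; last first.
  by move=> [k _ /(_ i)]; rewrite !mxE eqxx.
move=> xi; have [k _ xk] : (\bigcup_k cube k) x by rewrite bigcup_cube.
exists k => // j; rewrite !mxE; case: eqP => [->//|_].
by have := xk j; rewrite !mxE.
Qed.

Lemma rV_measure_unique (m1 m2 : {measure set V -> \bar R}) :
  (forall a b, m1 (box a b) = m2 (box a b)) ->
  (forall a b, (m1 (box a b) < +oo)%E) ->
  forall A, measurable A -> m1 A = m2 A.
Proof.
move=> m12 m1oo; apply: (measure_unique boxes cube measurable_boxes boxes_setI) => //.
- by move=> k; exact: box_boxes.
- exact: bigcup_cube.
- by move=> _ [[a b] _ <-].
- by move=> k; exact: m1oo.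
Qed.

Lemma lebesgue_box a b : mu (box a b) = (\prod_(i < n) (Num.max 0 (b ord0 i - a ord0 i))%:E)%E.
Proof.
rewrite /box (lebesgue_rV_box (A := fun i => `]a ord0 i, b ord0 i]%classic))//.
apply: eq_bigr => i _; rewrite lebesgue_measure_itv /= lte_fin.
case: ltP => ab; first by rewrite max_r// subr_ge0 ltW.
by rewrite max_l// subr_le0.
Qed.

Lemma lebesgue_box_lty a b : (mu (box a b) < +oo)%E.
Proof. by rewrite lebesgue_box prodEFin ltry. Qed.

Lemma measurable_shift c : measurable_fun setT (fun x : V => x + c).
Proof.
apply: measurable_fun_rV => i.
rewrite (_ : (fun x => _) = (fun x : V => x ord0 i + c ord0 i)).
  by apply: measurable_funD => //; exact: measurable_coord_rV.
by apply/funext => x; rewrite mxE.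
Qed.

Lemma lebesgue_shift c A : measurable A -> mu ((fun x => x + c) @^-1` A) = mu A.
Proof.
move=> mA.
pose m := measure_function_pushforward__canonical__measure_function_Measure
  mu (measurable_shift c).
change (m A = mu A); apply: rV_measure_unique => // [a b|a b].
  transitivity (mu (box (a - c) (b - c))).
    congr (mu _); apply/seteqP; split => x /= H i; have := H i; rewrite !mxE /= !in_itv /=;
    by rewrite ltrBlDr lerBrDr.
  apply: (etrans (lebesgue_box _ _)); apply/esym/(etrans (lebesgue_box _ _)).
  apply: eq_bigr => i _; rewrite !mxE.
  by congr ((Num.max _ _)%:E); ring.
rewrite (_ : m _ = mu (box (a - c) (b - c))) ?lebesgue_box_lty//.
congr (mu _); apply/seteqP; split => x /= H i; have := H i; rewrite !mxE /= !in_itv /=;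
by rewrite ltrBlDr lerBrDr.
Qed.

Lemma ge0_integral_shift (f : V -> \bar R) c : measurable_fun setT f ->
  (forall x, 0 <= f x)%E -> (\int[mu]_x f (x + c)%R = \int[mu]_x f x)%E.
Proof.
move=> mf f0.
have := @ge0_integral_pushforward _ _ _ _ _ _ (measurable_shift c) mu setT f measurableT mf (fun x _ => f0 x).
rewrite preimage_setT => <-.
apply: eq_measure_integral => [|mf' A mA _]; first exact: measurable_shift.
by rewrite -[RHS](lebesgue_shift c mA).
Qed.

Lemma integrable_shift (f : V -> \bar R) c : mu.-integrable setT f ->
  mu.-integrable setT (fun x => f (x + c)).
Proof.
move=> /integrableP[mf foo]; apply/integrableP; split.
  by apply: (measurableT_comp mf); exact: measurable_shift.
by rewrite (ge0_integral_shift (f := fun x => `|f x|%E))//; exact: measurableT_comp.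
Qed.

Lemma Rintegral_shift (f : V -> R) c : mu.-integrable setT (EFin \o f) ->
  \int[mu]_x f (x + c) = \int[mu]_x f x.
Proof.
move=> fi; rewrite /Rintegral; congr fine.
have mf : measurable_fun setT (EFin \o f) by case/integrableP : fi.
have := @integral_pushforward _ _ _ _ _ _ (measurable_shift c) mu setT _ mf (integrable_shift c fi) measurableT.
rewrite preimage_setT => <-.
apply: eq_measure_integral => [|mf' A mA _]; first exact: measurable_shift.
by rewrite -[RHS](lebesgue_shift c mA).
Qed.

(** Measurable sets are generated by the coordinates while open sets come from the sup norm; the
    link is the countable base of cubes with rational centres and radii 1/(k + 1). *)
Lemma open_measurable_rV (U : set V) : open U -> measurable U.
Proof.
move=> oU.
pose q (u : 'rV[rat]_n * nat) : set V := [set x | forall i,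
  `]ratr (u.1 ord0 i) - u.2.+1%:R^-1, ratr (u.1 ord0 i) + u.2.+1%:R^-1[%classic (x ord0 i)].
rewrite (_ : U = \bigcup_u (if `[< q u `<=` U >] then q u else set0)); last first.
  apply/seteqP; split => [x Ux|x [u _]]; last by case: asboolP => // + ux; exact.
  have /nbhs_ballP[e /= e0 eU] := open_nbhs_nbhs (conj oU Ux).
  have [k _ /(_ k (leqnn k)) /= ke] := near_infty_natSinv_lt (PosNum (divr_gt0 e0 (ltr0n R 2))).
  set d : R := k.+1%:R^-1 in ke.
  have d0 : 0 < d by rewrite invr_gt0.
  have /choice[r rP] i : exists r : rat, ratr r \in `]x ord0 i - d, x ord0 i + d[.
    by apply: rat_in_itvoo; rewrite ltrBlDr -addrA ltrDl addr_gt0.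
  exists (\row_i r i, k) => //; case: asboolP => [_ i|[]].
    rewrite /= -/d mxE; have := rP i; rewrite !in_itv /= => /andP[r1 r2].
    by apply/andP; split; lra.
  move=> y qy; apply: eU; rewrite -ball_normE /= [ltLHS]mx_normrE.
  apply/bigmax_ltP; split => // -[i0 i] _; rewrite ord1 !mxE.
  have := qy i; have := rP i; rewrite /= -/d !mxE !in_itv /= => /andP[? ?] /andP[? ?].
  by rewrite ltr_norml; apply/andP; split; lra.
apply: countable_bigcupT_measurable => // u; case: ifP => // _.
exact: (measurable_coords (A := fun i =>
  `]ratr (u.1 ord0 i) - u.2.+1%:R^-1, ratr (u.1 ord0 i) + u.2.+1%:R^-1[%classic)).
Qed.

Lemma closed_measurable_rV (A : set V) : closed A -> measurable A.
Proof.
move=> cA; rewrite -(setCK A); apply: measurableC; apply: open_measurable_rV.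
exact: closed_openC.
Qed.

Lemma compact_measurable_rV (A : set V) : compact A -> measurable A.
Proof.
by move=> cA; apply: closed_measurable_rV; apply: compact_closed.
Qed.

Lemma continuous_measurable_rV (f : V -> R) : continuous f -> measurable_fun setT f.
Proof.
move=> cf; apply: (measurability _ (RGenOpens.measurableE R)) => //.
move=> _ [_ [a [b ->] <-]]; rewrite setTI.
by apply: open_measurable_rV; apply: open_comp => // x _; exact: cf.
Qed.

Lemma compact_sub_cube (A : set V) : compact A -> exists k, A `<=` cube k.
Proof.
move=> /compact_bounded[M [_ AM]].
exists (Num.truncn (M + 1)).+1 => x Ax; apply: cubeP.
by apply: le_lt_trans (truncnS_gt _); apply: AM => //; rewrite ltrDl.
Qed.

Lemma compact_lebesgue_lty (A : set V) : compact A -> (mu A < +oo)%E.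
Proof.
move=> cA; have [k Ak] := compact_sub_cube cA.
apply: le_lt_trans (lebesgue_box_lty (const_mx (- k%:R)) (const_mx k%:R)).
by apply: le_measure => //; rewrite inE; [exact: compact_measurable_rV|exact: measurable_box].
Qed.

End rV_measure.

(** * Smooth functions of one variable *)

Section smooth1.
Context {R : realType}.
Implicit Types (f g : R -> R) (t x : R).

Definition smooth1 f := forall k x, derivable (f^`(k))%classic x 1.

(** A coinduction principle: a class closed under differentiation contains only smooth functions. *)
Lemma smooth1_ind (A : set (R -> R)) :
  (forall f, A f -> exists2 f', A f' & forall x, is_derive x 1 f (f' x)) ->
  A `<=` smooth1.
Proof.
move=> HA f Af k; suff : A (f^`(k))%classic.
  by move=> /HA[f' _ ff'] x; have := ff' x; case.
elim: k => [|k /HA[f' Af' ff']]; first by rewrite derive1n0.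
rewrite derive1nS (_ : (_^`())%classic = f')//.
by apply/funext => x; rewrite derive1E; exact: derive_val.
Qed.

Lemma smooth1_derive f : smooth1 f -> smooth1 (f^`())%classic.
Proof. by move=> sf k x; rewrite -derive1Sn; exact: sf. Qed.

Lemma smooth1_is_derive f x : smooth1 f -> is_derive x 1 f (f^`() x)%classic.
Proof.
by move=> sf; rewrite derive1E; apply: derivableP; exact: (sf 0%N x).
Qed.

Lemma derivable1_continuous f : (forall x, derivable f x 1) -> continuous f.
Proof. by move=> df x; apply/differentiable_continuous/derivable1_diffP. Qed.

Lemma smooth1_continuous f : smooth1 f -> continuous f.
Proof. by move=> sf; apply: derivable1_continuous => x; exact: (sf 0%N x). Qed.

(** The generated class is closed under differentiation as a whole, so [smooth1_ind] yields
    smoothness without any formula for higher derivatives of products. *)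
Inductive smooth1_hull : (R -> R) -> Prop :=
| smooth1_hull_mem f : smooth1 f -> smooth1_hull f
| smooth1_hull_cst c : smooth1_hull (cst c)
| smooth1_hullD f g : smooth1_hull f -> smooth1_hull g ->
    smooth1_hull (fun x => f x + g x)
| smooth1_hullM f g : smooth1_hull f -> smooth1_hull g ->
    smooth1_hull (fun x => f x * g x)
| smooth1_hull_affine f a b : smooth1_hull f ->
    smooth1_hull (fun x => f (a * x + b)).

Lemma is_derive1_affine f df a b x : is_derive (a * x + b) 1 f df ->
  is_derive x 1 (fun x => f (a * x + b)) (df * a).
Proof.
move=> fd; apply: (@is_derive1_comp _ f (fun x => a * x + b)).
have -> : (fun x => a * x + b) = ((a \*: id) + cst b : R -> R) by [].
by apply: is_derive_eq; rewrite addr0 /GRing.scale /= mulr1.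
Qed.

Lemma smooth1_hullP : smooth1_hull `<=` smooth1.
Proof.
apply: smooth1_ind => f; elim => {f}.
- move=> f sf; exists (f^`())%classic => [|x]; last exact: smooth1_is_derive.
  exact/smooth1_hull_mem/smooth1_derive.
- by move=> c; exists (cst 0) => [|x]; [exact: smooth1_hull_cst|exact: is_derive_cst].
- move=> f g Hf [f' Hf' ff'] Hg [g' Hg' gg']; exists (fun x => f' x + g' x) => [|x].
    exact: smooth1_hullD.
  by have := ff' x; have := gg' x => *; exact: is_deriveD.
- move=> f g Hf [f' Hf' ff'] Hg [g' Hg' gg'].
  exists (fun x => f x * g' x + g x * f' x) => [|x].
    by apply: smooth1_hullD; exact: smooth1_hullM.
  by have := ff' x; have := gg' x => *; exact: is_deriveM.
- move=> f a b Hf [f' Hf' ff']; exists (fun x => f' (a * x + b) * a) => [|x].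
    by apply: smooth1_hullM; [exact: smooth1_hull_affine|exact: smooth1_hull_cst].
  exact: is_derive1_affine.
Qed.

(** One half of the exponential absorbs a factor [y], the other half the remaining polynomial; this
    is why the induction is over all [a]. *)
Lemma poly_le_expR (p : {poly R}) (a : R) : 0 < a ->
  exists C, forall y, 0 <= y -> `|p.[y]| <= C * expR (a * y).
Proof.
elim/poly_ind: p a => [|p c IH] a a0.
  by exists 0 => y _; rewrite horner0 normr0 mul0r.
have a20 : 0 < a / 2 by rewrite divr_gt0.
have [C HC] := IH _ a20.
exists (C * (a / 2)^-1 + `|c|) => y y0.
rewrite hornerMXaddC mulrDl (le_trans (ler_normD _ _))// lerD//; last first.
  rewrite ler_peMr//; have := expR_ge1Dx (a * y).
  by apply: le_trans; rewrite lerDl mulr_ge0// ltW.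
rewrite normrM (ger0_norm y0).
have -> : expR (a * y) = expR (a / 2 * y) * expR (a / 2 * y).
  by rewrite -expRD; congr expR; field.
rewrite mulrAC mulrA -mulrA ler_pM// ?HC//.
rewrite ler_pdivlMr// mulrC (le_trans _ (expR_ge1Dx _))//.
by rewrite lerDr.
Qed.

(** The classical function exp(-1/t) that vanishes to infinite order at 0; the polynomial factor in
    1/t makes the family closed under differentiation. *)
Definition flat (p : {poly R}) t := if 0 < t then p.[t^-1] * expR (- t^-1) else 0.

(** Applying [poly_le_expR] to [p * 'X] instead of [p] gains one factor of [t]. *)
Lemma flat_lin p : exists C, forall t, `|flat p t| <= C * `|t|.
Proof.
have [C HC] := poly_le_expR (p * 'X) ltr01; exists C => t.
have C0 : 0 <= C.
  by have := HC 0 (lexx _); rewrite mulr0 expR0 mulr1; apply: le_trans.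
rewrite /flat; case: ifPn => t0; last by rewrite normr0 mulr_ge0.
rewrite (gtr0_norm t0) normrM (ger0_norm (expR_ge0 _)) expRN.
rewrite ler_pdivrMr ?expR_gt0//.
have := HC t^-1; rewrite invr_ge0 ltW// => /(_ isT).
rewrite hornerMX normrM mul1r [`|t^-1|]gtr0_norm ?invr_gt0//.
by rewrite ler_pdivrMr// mulrAC.
Qed.

Lemma flat_continuous0 p : {for 0, continuous (flat p)}.
Proof.
have [C HC] := flat_lin p.
have f0 : flat p 0 = 0 by rewrite /flat ltxx.
apply/cvgrPdist_le => /= e e0; rewrite f0.
have C1 : 0 < `|C| + 1 by rewrite ltr_wpDl.
near=> t; rewrite sub0r normrN (le_trans (HC t))//.
apply: (@le_trans _ _ ((`|C| + 1) * `|t|)).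
  by apply: ler_wpM2r => //; rewrite (le_trans (ler_norm C))// lerDl.
rewrite mulrC -ler_pdivlMr//; near: t.
have : 0 < e / (`|C| + 1) by rewrite divr_gt0.
by move=> /(@nbhs0_le _ R^o).
Unshelve. all: by end_near. Qed.

Lemma is_derive_flat p t : is_derive t 1 (flat p) (flat ('X^2 * (p - p^`())) t).
Proof.
have [t0|t0|->] := ltgtP t 0.
- have -> : flat ('X^2 * (p - p^`())) t = 0 by rewrite /flat ltNge (ltW t0).
  apply: (@near_eq_is_derive _ _ _ (cst 0)).
  near=> s; rewrite /flat ifF// ltNge; apply/negbF; near: s.
  by exact: lt_le_nbhsl.
- have -> : flat ('X^2 * (p - p^`())) t = ('X^2 * (p - p^`())).[t^-1] * expR (- t^-1).
    by rewrite /flat t0.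
  have tn0 : id t != 0 by rewrite gt_eqF.
  have dV := is_deriveV tn0 (is_derive_id t 1).
  have d1 : is_derive t 1 (horner p \o (fun y : R => y^-1)) (p^`().[t^-1] * (- t ^- 2 *: 1)).
    exact: is_derive1_comp.
  have d2 : is_derive t 1 (expR \o (- (fun y : R => y^-1))) (expR (- t^-1) * - (- t ^- 2 *: 1)).
    exact: is_derive1_comp.
  have d3 : is_derive t 1 ((horner p \o (fun y : R => y^-1)) * (expR \o (- (fun y : R => y^-1))))
      (('X^2 * (p - p^`())).[t^-1] * expR (- t^-1)).
    apply: is_derive_eq (is_deriveM d1 d2) _ => /=.
    rewrite !hornerE /GRing.scale /= -exprVn; ring.
  apply: near_eq_is_derive d3.
  near=> s; rewrite /flat ifT//; near: s.
  exact: lt_nbhsr.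
- have f0 q : flat q 0 = 0 by rewrite /flat ltxx.
  (* At 0 the difference quotient of [flat p] is again a function of the family, continuous there
     with value 0. *)
  apply/is_derive1_caratheodory; exists (flat (p * 'X)); split.
  + move=> z; rewrite f0 !subr0 /flat; case: ifPn => [z0|]; last by rewrite mul0r.
    by rewrite hornerMX; field; rewrite gt_eqF.
  + exact: flat_continuous0.
  + by rewrite !f0.
Unshelve. all: by end_near. Qed.

Lemma smooth1_flat p : smooth1 (flat p).
Proof.
apply: (@smooth1_ind (range flat)); last by exists p.
move=> _ [q _ <-]; exists (flat ('X^2 * (q - q^`()))); first by exists (('X^2 * (q - q^`()))).
exact: is_derive_flat.
Qed.

Lemma primitive0 f : continuous f -> (forall t, t <= 0 -> f t = 0) ->
  exists2 F, (forall x, is_derive x 1 F (f x)) & (forall x, x <= 0 -> F x = 0).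
Proof.
move=> cf f0.
(* The integral starts at -1 since the fundamental theorem of calculus only applies in
   the interior of the integration domain. *)
pose F (x : R) := (\int[lebesgue_measure]_(t in [set` `[-1, x]]) (f t))%R.
have F0 x : x <= 0 -> F x = 0.
  move=> x0; rewrite /F /Rintegral integral0_eq// => y /=.
  by rewrite in_itv /= => /andP[_ yx]; rewrite f0// (le_trans yx).
exists F => // x; have [x0|x0] := ltP x 0.
  rewrite f0 ?(ltW x0)//; apply: (@near_eq_is_derive _ _ _ (cst 0)).
  near=> s; rewrite /= F0//; near: s; exact: lt_le_nbhsl.
have [] := @continuous_FTC1_closed _ f (-1) x (x + 1) _ _ _ _.
- by rewrite ltrDl.
- apply: continuous_compact_integrable; first exact: segment_compact.
  by apply: continuous_subspaceT => y; exact: cf.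
- by rewrite (lt_le_trans _ x0)// ltrN10.
- exact: cf.
by move=> dF <-; rewrite derive1E; exact: derivableP.
Unshelve. all: by end_near. Qed.

Lemma smooth1_primitive f F : smooth1 f -> (forall x, is_derive x 1 F (f x)) ->
  smooth1 F.
Proof.
move=> sf dF; apply: (@smooth1_ind [set g | g = F \/ smooth1 g]); last by left.
move=> g [->|sg]; first by exists f => //; right.
exists (g^`())%classic; first by right; exact: smooth1_derive.
by move=> x; exact: smooth1_is_derive.
Qed.

Lemma is_derive_ge0_homo F f : (forall x, is_derive x 1 F (f x)) ->
  (forall x, 0 <= f x) -> {homo F : x y / x <= y}.
Proof.
move=> dF f0 x y xy.
have [|c _ FE] := @MVT_segment _ F f x y xy.
- apply: continuous_subspaceT; apply: derivable1_continuous => z.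
  by have := dF z; case.
by rewrite -subr_ge0 FE mulr_ge0// subr_ge0.
Qed.

(** A normalized primitive of a bump that is positive exactly on the interval ]0, 1[. *)
Lemma smooth_step : exists s : R -> R, [/\ smooth1 s,
  forall t, t <= 0 -> s t = 0, forall t, 1 <= t -> s t = 1 &
  {homo s : x y / x <= y}].
Proof.
pose b t := flat 1 t * flat 1 ((- 1) * t + 1).
have sb : smooth1 b.
  apply: smooth1_hullP; apply: smooth1_hullM.
    exact/smooth1_hull_mem/smooth1_flat.
  exact/smooth1_hull_affine/smooth1_hull_mem/smooth1_flat.
have flat0 t : t <= 0 -> flat 1 t = 0 by rewrite /flat ltNge => ->.
have flatp t : 0 < t -> 0 < flat 1 t.
  by move=> t0; rewrite /flat t0 hornerC mul1r expR_gt0.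
have flatge0 t : 0 <= flat 1 t.
  by have [/flat0->|/flatp/ltW] := lerP t 0.
have b_ge0 t : 0 <= b t by rewrite mulr_ge0.
have b0 t : t <= 0 -> b t = 0 by move=> /flat0; rewrite /b => ->; rewrite mul0r.
have [F dF F0] := primitive0 (smooth1_continuous sb) b0.
have hF := is_derive_ge0_homo dF b_ge0.
have F1 : 0 < F 1.
  have [|c] := @MVT _ F b 0 1 ltr01.
  - apply: continuous_subspaceT; apply: derivable1_continuous => z.
    by have := dF z; case.
  rewrite in_itv /= => /andP[c0 c1] ; rewrite (F0 0)// !subr0 mulr1 => ->.
  by rewrite mulr_gt0 ?flatp//; lra.
have Fc t : 1 <= t -> F t = F 1.
  move=> t1; have [|c] := @MVT_segment _ F b 1 t t1.
  - apply: continuous_subspaceT; apply: derivable1_continuous => z.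
    by have := dF z; case.
  rewrite in_itv /= => /andP[c1 _]; rewrite /b (flat0 (-1 * c + 1)); last lra.
  by rewrite mulr0 mul0r => /eqP; rewrite subr_eq0 => /eqP.
exists (fun t => cst (F 1)^-1 t * F t); split.
- apply: smooth1_hullP; apply: smooth1_hullM; first exact: smooth1_hull_cst.
  exact/smooth1_hull_mem/(smooth1_primitive sb).
- by move=> t t0; rewrite /= (F0 t t0) mulr0.
- by move=> t t1; rewrite /= (Fc t t1) mulVf ?gt_eqF.
- by move=> x y xy /=; rewrite ler_pM2l ?invr_gt0//; exact: hF.
Qed.

(** A smooth substitute for truncation to [0, 1]. Reaching 1 already at [1 - d] turns closeness to 1
    into equality, at the price of a slope slightly above 1. *)
Lemma smooth_ramp (d : R) : 0 < d < 2^-1 -> exists T : R -> R, [/\ smooth1 T,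
  forall t, t <= 0 -> T t = 0, forall t, 1 - d <= t -> T t = 1,
  forall t, 0 <= T t <= 1 &
  forall t, 0 <= (T^`())%classic t <= (1 - 2 * d)^-1].
Proof.
move=> /andP[d0 d2].
have [s [ss s0 s1 hs]] := smooth_step.
have s01 t : 0 <= s t <= 1.
  have [t0|t0] := lerP t 0; first by rewrite s0// lexx ler01.
  have [t1|t1] := lerP 1 t; first by rewrite s1// lexx ler01.
  by rewrite -(s0 _ (lexx 0)) -(s1 _ (lexx 1)) !hs// ltW.
have [P dP P0] := primitive0 (smooth1_continuous ss) s0.
have P1 t : 1 <= t -> P t = P 1 + (t - 1).
  move=> t1; have [|c] := @MVT_segment _ P s 1 t t1.
  - apply: continuous_subspaceT; apply: derivable1_continuous => z.
    by have := dP z; case.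
  rewrite in_itv /= => /andP[c1 _]; rewrite (s1 c)// mul1r => /eqP.
  by rewrite subr_eq addrC => /eqP.
pose L := 1 - 2 * d; have L0 : 0 < L by rewrite /L; lra.
(* [T t = d / L * (P (t / d) - P ((t - L) / d))], where [P' = s]. *)
pose T t := cst (d / L) t * (P (d^-1 * t + 0) + cst (-1) t * P (d^-1 * t + (- (L / d)))).
pose dT t := (d / L) * (s (d^-1 * t + 0) * d^-1 + (-1) * (s (d^-1 * t + (- (L / d))) * d^-1)).
have sP : smooth1_hull P by exact/smooth1_hull_mem/(smooth1_primitive ss).
have TdT t : is_derive t 1 T (dT t).
  have h1 := is_derive1_affine (dP (d^-1 * t + 0)).
  have h2 := is_derive1_affine (dP (d^-1 * t + - (L / d))).
  have h3 := is_deriveZ (d / L) (is_deriveD h1 (is_deriveZ (-1) h2)).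
  exact: h3.
have dT_ge0 t : 0 <= dT t <= L^-1.
  have dd : 0 < d^-1 by rewrite invr_gt0.
  have LL : 0 < L / d by rewrite divr_gt0.
  have hh : s (d^-1 * t + - (L / d)) <= s (d^-1 * t + 0) by apply: hs; rewrite lerD2l; lra.
  have -> : dT t = L^-1 * (s (d^-1 * t + 0) - s (d^-1 * t + - (L / d))).
    by rewrite /dT; field; rewrite !gt_eqF.
  have := s01 (d^-1 * t + 0); have := s01 (d^-1 * t + - (L / d)).
  move=> /andP[? ?] /andP[? ?]; apply/andP; split.
    by rewrite mulr_ge0 ?invr_ge0 ?(ltW L0)// subr_ge0.
  by rewrite ler_piMr ?invr_ge0 ?(ltW L0)//; lra.
have T0 t : t <= 0 -> T t = 0.
  move=> t0; have h : d^-1 * t <= 0 by rewrite mulr_ge0_le0// invr_ge0 ltW.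
  have LL : 0 < L / d by rewrite divr_gt0.
  rewrite /T (P0 (_ + 0)) ?addr0// (P0 (_ - _)); last lra.
  by rewrite mulr0 addr0 mulr0.
have T1 t : 1 - d <= t -> T t = 1.
  move=> td; have h : d^-1 * (1 - d) <= d^-1 * t by rewrite ler_pM2l ?invr_gt0.
  (* Both arguments of [P] are then at least 1, where [P] has slope 1; the two values differ by
     [L / d], which the factor [d / L] normalizes to 1. *)
  have h1 : d^-1 * (1 - d) = L / d + 1 by rewrite /L; field; rewrite gt_eqF.
  have LL : 0 < L / d by rewrite divr_gt0.
  rewrite /T (P1 (_ + 0)) ?(P1 (_ - _)); [|lra|lra].
  rewrite /=; field; by rewrite !gt_eqF.
exists T; split; [|exact: T0|exact: T1| |].
- by apply: smooth1_hullP; apply: smooth1_hullM; [exact: smooth1_hull_cst|];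
  apply: smooth1_hullD; [exact: smooth1_hull_affine|];
  apply: smooth1_hullM; [exact: smooth1_hull_cst|exact: smooth1_hull_affine].
- have hT : {homo T : x y / x <= y}.
    by apply: (is_derive_ge0_homo TdT) => x; have /andP[] := dT_ge0 x.
  move=> t; have [t0|t0] := lerP t 0; first by rewrite T0// lexx ler01.
  have [t1|t1] := lerP (1 - d) t; first by rewrite T1// lexx ler01.
  by rewrite -(T0 _ (lexx 0)) -(T1 _ (lexx (1 - d))) !hT// ltW.
- by move=> t; rewrite derive1E (derive_val (is_derive := TdT t)).
Qed.

End smooth1.

(** * Test functions *)

Section smooth.
Context {R : realType} {n : nat}.
Local Notation V := 'rV[R]_n.
Local Notation e_ i := (delta_mx ord0 i : V).
Implicit Types (f g : V -> R) (x v c : V).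

Lemma mx_norm_coord m k (x : 'M[R]_(m, k)) i j : `|x i j| <= `|x|.
Proof. by rewrite [leRHS]mx_normrE (le_bigmax _ _ (i, j)). Qed.

(** Transfers the one-variable chain rule and mean value theorem to directional derivatives. *)
Lemma is_derive_line f x v df :
  is_derive x v f df <-> is_derive (0 : R) 1 (fun h : R => f (h *: v + x)) df.
Proof.
have E : 'D_v f x = 'D_1 (fun h : R => f (h *: v + x)) 0.
  rewrite /derive; set g1 := (fun h => h^-1 *: _); set g2 := (fun h => h^-1 *: _).
  suff -> : g1 = g2 by [].
  by rewrite funeqE /g1 /g2 => h /=; rewrite addr0 scale0r add0r [_%:A]mulr1.
split=> -[d Ddf]; split.
- exact: (derivable1P _ _ _).1 d.
- by rewrite -E.
- exact: (derivable1P _ _ _).2 d.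
- by rewrite E.
Qed.

Lemma is_derive_comp1 (T : R -> R) f x v dT df :
  is_derive (f x) 1 T dT -> is_derive x v f df -> is_derive x v (T \o f) (dT * df).
Proof.
move=> dT' /is_derive_line df'; apply/is_derive_line.
apply: (@is_derive1_comp _ T (fun h : R => f (h *: v + x))).
by rewrite scale0r add0r.
Qed.

Lemma is_derive_shift_rV f x v c df :
  is_derive (x + c) v f df -> is_derive x v (fun y => f (y + c)) df.
Proof.
move=> /is_derive_line H; apply/is_derive_line.
by under eq_fun do rewrite -addrA.
Qed.

Lemma is_derive_coord x i j :
  is_derive x (e_ i) (fun y : V => y ord0 j) (i == j)%:R.
Proof.
apply/is_derive_line.
rewrite (_ : (fun h : R => _) = fun h : R => id ((i == j)%:R * h + x ord0 j)).
  rewrite -[X in is_derive _ _ _ X]mul1r.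
  by apply: is_derive1_affine; exact: is_derive_id.
by apply/funext => h; rewrite !mxE eqxx /= mulrC [in RHS]eq_sym.
Qed.

Lemma smooth_ind (A : set (V -> R)) :
  (forall f, A f -> continuous f /\ forall i, exists2 f', A f' &
    forall x, is_derive x (e_ i) f (f' x)) ->
  A `<=` smooth.
Proof.
move=> HA f Af s.
have As : A (iter_partial s f).
  elim: s => [//|i s /= /HA[_ /(_ i)[f' Af' ff']]].
  by rewrite (_ : 'D_ _ _ = f')//; apply/funext => x; exact: derive_val.
have [cf df] := HA _ As; split => // i x.
by have [f' _ /(_ x)[]] := df i.
Qed.

Lemma smooth_continuous f : smooth f -> continuous f.
Proof. by move=> /(_ [::])[]. Qed.

Lemma smooth_is_derive f i x : smooth f -> is_derive x (e_ i) f ('D_(e_ i) f x).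
Proof. by move=> /(_ [::])[_ df]; apply: derivableP; exact: df. Qed.

Lemma smooth_partial f i : smooth f -> smooth ('D_(e_ i) f).
Proof.
move=> sf s; have := sf (rcons s i).
by rewrite /iter_partial foldr_rcons.
Qed.

Inductive smooth_hull : (V -> R) -> Prop :=
| smooth_hull_mem f : smooth f -> smooth_hull f
| smooth_hull_cst r : smooth_hull (cst r)
| smooth_hull_coord i : smooth_hull (fun x => x ord0 i)
| smooth_hullD f g : smooth_hull f -> smooth_hull g -> smooth_hull (f + g)
| smooth_hullM f g : smooth_hull f -> smooth_hull g -> smooth_hull (f * g)
| smooth_hull_comp T f : smooth1 T -> smooth_hull f -> smooth_hull (T \o f)
| smooth_hull_shift f c : smooth_hull f -> smooth_hull (fun x => f (x + c)).

Lemma smooth_hullP : smooth_hull `<=` smooth.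
Proof.
apply: smooth_ind => f; elim => {f}.
- move=> f sf; split; first exact: smooth_continuous.
  move=> i; exists ('D_(e_ i) f); last by move=> x; exact: smooth_is_derive.
  exact/smooth_hull_mem/smooth_partial.
- move=> r; split=> [|i]; first exact: cst_continuous.
  by exists (cst 0); [exact: smooth_hull_cst|move=> x; exact: is_derive_cst].
- move=> j; split=> [|i]; first exact: coord_continuous.
  exists (cst (i == j)%:R); first exact: smooth_hull_cst.
  by move=> x; exact: is_derive_coord.
- move=> f g hf [cf df] hg [cg dg]; split=> [x|i].
    by apply: continuousD; [exact: cf|exact: cg].
  have [f' hf' ff'] := df i; have [g' hg' gg'] := dg i.
  by exists (f' + g'); [exact: smooth_hullD|move=> x; exact: is_deriveD].
- move=> f g hf [cf df] hg [cg dg]; split=> [x|i].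
    by apply: continuousM; [exact: cf|exact: cg].
  have [f' hf' ff'] := df i; have [g' hg' gg'] := dg i.
  exists (f * g' + g * f'); last by move=> x; exact: is_deriveM.
  by apply: smooth_hullD; exact: smooth_hullM.
- move=> T f sT hf [cf df]; split=> [x|i].
    by apply: continuous_comp; [exact: cf|exact: smooth1_continuous].
  have [f' hf' ff'] := df i; exists (((T^`())%classic \o f) * f').
    apply: smooth_hullM => //; apply: smooth_hull_comp => //.
    exact: smooth1_derive.
  by move=> x; apply: is_derive_comp1; exact: smooth1_is_derive.
- move=> f c hf [cf df]; split=> [x|i].
    apply: (@continuous_comp _ _ _ (fun y : V => y + c) f); last exact: cf.
    by apply: continuousD => //; exact: cst_continuous.
  have [f' hf' ff'] := df i; exists (fun x => f' (x + c)).
    exact: smooth_hull_shift.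
  by move=> x; exact: is_derive_shift_rV.
Qed.

(** Vanishing outside a ball is easier to propagate through sums, translations and compositions than
    compactness of the closed support. *)
Lemma Cc_inftyP f : Cc_infty f <-> smooth f /\ exists M, forall x, M < `|x| -> f x = 0.
Proof.
split=> [[sf /compact_bounded[M [_ HM]]]|[sf [M HM]]]; split=> //.
  exists (M + 1) => x xM; apply/eqP/negPn/negP => fx.
  have : `|x| <= M + 1.
    by apply: HM; [rewrite ltrDl|apply: subset_closure].
  by rewrite leNgt xM.
have clM : closed [set x : V | `|x| <= M].
  apply: (@closed_comp _ _ (fun x : V => `|x|) [set r | r <= M]).
    by move=> x _; exact: norm_continuous.
  exact: closed_le.
have sub : closure [set x | f x != 0] `<=` [set x : V | `|x| <= M].
  rewrite [X in _ `<=` X]((closure_id _).1 clM); apply: closure_subset => x /= fx.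
  by rewrite leNgt; apply/negP => /HM fx0; rewrite fx0 eqxx in fx.
apply: bounded_closed_compact; last exact: closed_closure.
exists M; split; first exact: num_real.
by move=> r Mr x /sub /= xM; rewrite (le_trans xM)// ltW.
Qed.

Lemma Cc_infty_smooth f : Cc_infty f -> smooth f. Proof. by case. Qed.

Lemma Cc_infty_continuous f : Cc_infty f -> continuous f.
Proof. by case=> /smooth_continuous. Qed.

Lemma Cc_inftyD f g : Cc_infty f -> Cc_infty g -> Cc_infty (f + g).
Proof.
move=> /Cc_inftyP[sf [M HM]] /Cc_inftyP[sg [N HN]]; apply/Cc_inftyP; split.
  by apply: smooth_hullP; apply: smooth_hullD; exact: smooth_hull_mem.
exists (Num.max M N) => x; rewrite gt_max => /andP[/HM xM /HN xN].
by have -> : (f + g) x = f x + g x by []; rewrite xM xN addr0.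
Qed.

Lemma Cc_inftyM f g : smooth f -> Cc_infty g -> Cc_infty (f * g).
Proof.
move=> sf /Cc_inftyP[sg [N HN]]; apply/Cc_inftyP; split.
  by apply: smooth_hullP; apply: smooth_hullM; exact: smooth_hull_mem.
exists N => x /HN xN; have -> : (f * g) x = f x * g x by [].
by rewrite xN mulr0.
Qed.

Lemma Cc_inftyZ (r : R) f : Cc_infty f -> Cc_infty (fun x => r * f x).
Proof. by apply: Cc_inftyM; exact/smooth_hullP/smooth_hull_cst. Qed.

Lemma Cc_infty_comp (T : R -> R) f : smooth1 T -> T 0 = 0 -> Cc_infty f ->
  Cc_infty (T \o f).
Proof.
move=> sT T0 /Cc_inftyP[sf [M HM]]; apply/Cc_inftyP; split.
  by apply: smooth_hullP; apply: smooth_hull_comp => //; exact: smooth_hull_mem.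
by exists M => x /HM xM /=; rewrite xM.
Qed.

Lemma Cc_infty_shift f c : Cc_infty f -> Cc_infty (fun x => f (x + c)).
Proof.
move=> /Cc_inftyP[sf [M HM]]; apply/Cc_inftyP; split.
  by apply: smooth_hullP; apply: smooth_hull_shift; exact: smooth_hull_mem.
exists (M + `|c|) => x Mx; apply: HM.
have := ler_normD (x + c) (- c); rewrite addrK normrN; lra.
Qed.

Lemma Cc_infty_partial f i : Cc_infty f -> Cc_infty ('D_(e_ i) f).
Proof.
move=> /Cc_inftyP[sf [M HM]]; apply/Cc_inftyP; split; first exact: smooth_partial.
exists M => x Mx.
have oM : open [set y : V | M < `|y|].
  apply: (@open_comp _ _ (fun x : V => `|x|) [set r | M < r]).
    by move=> y _; exact: norm_continuous.
  exact: open_gt.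
rewrite (@near_eq_derive _ _ _ _ (cst 0)) ?derive_cst//.
by apply: filterS (open_nbhs_nbhs (conj oM Mx)) => y /= /HM.
Qed.

Lemma Cc_infty0 : Cc_infty (cst 0 : V -> R).
Proof.
apply/Cc_inftyP; split; first exact/smooth_hullP/smooth_hull_cst.
by exists 0.
Qed.

Lemma Cc_infty_bounded f : Cc_infty f -> exists2 B, 0 <= B & forall x, `|f x| <= B.
Proof.
move=> /[dup] /Cc_infty_continuous cf [_ cK].
have [B [Br HB]] := compact_bounded (continuous_compact
  (continuous_subspaceT cf) cK).
exists (Num.max 0 (B + 1)); first by rewrite le_max lexx.
move=> x; have [->|fx] := eqVneq (f x) 0; first by rewrite normr0 le_max lexx.
rewrite le_max; apply/orP; right; apply: (HB (B + 1)); first by rewrite ltrDl.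
by exists x => //; apply: subset_closure.
Qed.

(** In each coordinate the factor climbs just to the right of [a] and drops just to the right of
    [b]. As the step vanishes at 0, the limit is 0 at [a] and 1 at [b] when [a < b], which gives
    half-open boxes. The common support serves dominated convergence. *)
Lemma box_test_fun (a b : V) : exists chi : nat -> V -> R, [/\ forall m, Cc_infty (chi m),
  forall m x, 0 <= chi m x <= 1,
  exists M, forall m x, M < `|x| -> chi m x = 0 &
  forall x, chi m x @[m --> \oo] --> (\1_(box a b) x : R)].
Proof.
have [s [ss s0 s1 hs]] := @smooth_step R.
have s01 t : 0 <= s t <= 1.
  have [t0|t0] := lerP t 0; first by rewrite s0// lexx ler01.
  have [t1|t1] := lerP 1 t; first by rewrite s1// lexx ler01.
  by rewrite -(s0 _ (lexx 0)) -(s1 _ (lexx 1)) !hs// ltW.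
pose q m i t := s (m.+1%:R * t + - (m.+1%:R * a ord0 i)) *
  (1 + (-1) * s (m.+1%:R * t + - (m.+1%:R * b ord0 i))).
have q01 m i t : 0 <= q m i t <= 1.
  have /andP[u0 u1] := s01 (m.+1%:R * t + - (m.+1%:R * a ord0 i)).
  have /andP[v0 v1] := s01 (m.+1%:R * t + - (m.+1%:R * b ord0 i)).
  by apply/andP; split; [apply: mulr_ge0|apply: mulr_ile1]; lra.
have q0 m i t : (t <= a ord0 i) || (b ord0 i + 1 <= t) -> q m i t = 0.
  move=> /orP[ta|tb].
    by rewrite /q s0 ?mul0r// -mulrBr mulr_ge0_le0// subr_le0.
  have h : 1 <= m.+1%:R * t + - (m.+1%:R * b ord0 i).
    rewrite -mulrBr (@le_trans _ _ (1 * (t - b ord0 i)))//; first lra.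
    by rewrite ler_wpM2r ?ler1n//; lra.
  by rewrite /q (s1 _ h) mulr1 subrr mulr0.
have near1 (c : R) : 0 < c -> \forall m \near \oo, 1 <= m.+1%:R * c.
  move=> c0; near=> m; rewrite -ler_pdivrMr// mul1r.
  rewrite (@le_trans _ _ m%:R) ?ler_nat//; near: m; exact: nbhs_infty_ger.
have qlim i t : \forall m \near \oo, q m i t = \1_(`]a ord0 i, b ord0 i]%classic) t.
  rewrite indicE mem_setE in_itv /=; case: ltP => /= [ta|ta]; last first.
    by near=> m; rewrite q0// ta.
  have ta0 : 0 < t - a ord0 i by rewrite subr_gt0.
  case: leP => [tb|tb].
    near=> m; rewrite /q s1; last by rewrite -mulrBr; near: m; exact: near1.
    by rewrite s0 ?mulr0 ?addr0 ?mulr1// -mulrBr mulr_ge0_le0// subr_le0.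
  have tb0 : 0 < t - b ord0 i by rewrite subr_gt0.
  near=> m; rewrite /q (s1 (_ - m.+1%:R * b _ _)) ?mulr1 ?subrr ?mulr0//.
  by rewrite -mulrBr; near: m; exact: near1.
have supp m x : `|a| + `|b| + 1 < `|x| -> \prod_(i < n) q m i (x ord0 i) = 0.
  apply: contraPeq => /prodf_neq0 qn0; apply/negP; rewrite -leNgt.
  rewrite [leLHS]mx_normrE; apply/bigmax_leP; split=> [|[i0 i] _].
    by rewrite !addr_ge0.
  rewrite ord1 /=; have := qn0 i isT; have := q0 m i (x ord0 i).
  case: leP => [_ ->//|ax]; first by rewrite eqxx.
  case: leP => [_ ->//|bx _ _]; first by rewrite eqxx.
  have := mx_norm_coord a ord0 i; have := mx_norm_coord b ord0 i.
  rewrite !ler_norml => /andP[? ?] /andP[? ?].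
  by apply/andP; split; lra.
exists (fun m x => \prod_(i < n) q m i (x ord0 i)); split.
- move=> m; apply/Cc_inftyP; split.
    rewrite (_ : (fun x => _) = \big[*%R/cst 1]_(i < n) (fun x : V => q m i (x ord0 i))); last first.
      apply/funext => x; elim/big_rec2 : _ => // i v u _ uv.
      by have -> : ((fun x : V => q m i (x ord0 i)) * v) x = q m i (x ord0 i) * v x by []; rewrite uv.
    apply: smooth_hullP; elim/big_ind : _ => [|f g|i _].
    + exact: smooth_hull_cst.
    + exact: smooth_hullM.
    + apply: (@smooth_hull_comp (q m i) (fun x : V => x ord0 i)).
        by apply: smooth1_hullP; apply: smooth1_hullM;
          [apply: smooth1_hull_affine|apply: smooth1_hullD;
            [exact: smooth1_hull_cst|apply: smooth1_hullM;
              [exact: smooth1_hull_cst|apply: smooth1_hull_affine]]];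
          exact: smooth1_hull_mem.
      exact: smooth_hull_coord.

  by exists (`|a| + `|b| + 1) => x; exact: supp.
- move=> m x; apply/andP; split; first by apply: prodr_ge0 => i _; have /andP[] := q01 m i (x ord0 i).
  by apply: prodr_ile1 => i _; exact: q01.
- by exists (`|a| + `|b| + 1).
- move=> x; apply: cvg_near_cst.
  have /filter_forall : forall i, \forall m \near \oo,
    q m i (x ord0 i) = \1_(`]a ord0 i, b ord0 i]%classic) (x ord0 i) by move=> i; exact: qlim.
  apply: filterS => m Hm; under eq_bigr do rewrite Hm.
  rewrite indicE; case: (pselect (box a b x)) => [bx|nbx].
    by rewrite mem_set// big1// => i _; rewrite indicE mem_set//; exact: bx.
  rewrite memNset//; apply/eqP; rewrite prodf_seq_eq0.
  have /existsNP[i nbi] := nbx.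
  apply/hasP; exists i; rewrite ?mem_index_enum//= indicE memNset//.
Unshelve. all: by end_near. Qed.

End smooth.

(** * Weak gradients *)

Section weak.
Context {R : realType} {n : nat}.
Local Notation V := 'rV[R]_n.
Local Notation mu := (@lebesgue_rV R n).
Local Notation e_ i := (delta_mx ord0 i : V).
Implicit Types (f g d phi : V -> R) (x v c : V) (M : R).

Definition cball M : set V := [set x | `|x| <= M].

Lemma cball_compact M : compact (cball M).
Proof.
apply: bounded_closed_compact; last first.
  apply: (@closed_comp _ _ (fun x : V => `|x|) [set r | r <= M]).
    by move=> x _; exact: norm_continuous.
  exact: closed_le.
exists M; split; first exact: num_real.
by move=> r Mr x /= xM; rewrite (le_trans xM)// ltW.
Qed.

Lemma measurable_cball M : measurable (cball M).
Proof. by apply: compact_measurable_rV; exact: cball_compact. Qed.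

Lemma notin_cball M x : ~ cball M x -> M < `|x|.
Proof. by move=> /negP; rewrite -ltNge. Qed.

Lemma integrable_patch (D : set V) f : measurable D ->
  (forall x, ~ D x -> f x = 0) ->
  mu.-integrable D (EFin \o f) -> mu.-integrable setT (EFin \o f).
Proof.
move=> mD f0 /(integrable_mkcond _ mD).
rewrite (_ : (EFin \o f) \_ D = EFin \o f)//; apply/funext => x; rewrite patchE.
by case: ifPn => // /negP; rewrite inE => /f0 /= ->.
Qed.

Lemma integrable_locally_bounded d phi M B : locally_integrable_rV d ->
  measurable_fun setT phi -> (forall x, `|phi x| <= B) ->
  (forall x, M < `|x| -> phi x = 0) ->
  mu.-integrable setT (fun x => (d x * phi x)%:E).
Proof.
move=> [md di] mphi phiB phi0.
have mb := measurable_cball M.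
apply: (@integrable_patch (cball M)) => //.
  by move=> x /notin_cball/phi0 ->; rewrite mulr0.
have iB := integrableZl mb B (di _ (@cball_compact M)).
apply: (le_integrable mb _ _ iB).
  apply/measurable_EFinP/measurable_funM; exact: measurable_funTS.
move=> x _ /=; rewrite lee_fin !normrM mulrC ler_wpM2r//.
by rewrite (le_trans (phiB x))// ler_norm.
Qed.

Lemma integrable_bounded_support f M B : measurable_fun setT f ->
  (forall x, `|f x| <= B) -> (forall x, M < `|x| -> f x = 0) ->
  mu.-integrable setT (EFin \o f).
Proof.
move=> mf fB f0; have mb := measurable_cball M.
apply: (@integrable_patch (cball M)) => //.
  by move=> x /notin_cball/f0.
apply: measurable_bounded_integrable => //.
- by apply: compact_lebesgue_lty; exact: cball_compact.
- exact: measurable_funTS.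
- exists B; split; first exact: num_real.
  by move=> r Br x _; exact: le_trans (fB x) (ltW Br).
Qed.

Lemma Cc_infty_measurable f : Cc_infty f -> measurable_fun setT f.
Proof. by move=> /Cc_infty_continuous; exact: continuous_measurable_rV. Qed.

Lemma Cc_infty_integrable f : Cc_infty f -> mu.-integrable setT (EFin \o f).
Proof.
move=> cf; have [B _ fB] := Cc_infty_bounded cf.
have /Cc_inftyP[_ [M f0]] := cf.
by apply: (integrable_bounded_support _ fB f0); exact: Cc_infty_measurable.
Qed.

Lemma Cc_infty_locally_integrable f : Cc_infty f -> locally_integrable_rV f.
Proof.
move=> cf; split; first exact: Cc_infty_measurable.
move=> C cC; apply: (integrableS measurableT) => //; first exact: compact_measurable_rV.
exact: Cc_infty_integrable.
Qed.

Lemma is_derive_along f (df : V -> R) v x (t : R) : (forall y, is_derive y v f (df y)) ->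
  is_derive t 1 (fun h : R => f (h *: v + x)) (df (t *: v + x)).
Proof.
move=> dfv; have /is_derive_line := dfv (t *: v + x).
rewrite -{1}(subrr t) -{1}[t]mul1r => /is_derive1_affine.
rewrite mulr1; under eq_fun do rewrite mul1r addrA -scalerDl subrK.
by [].
Qed.

Lemma increment_le f (df : V -> R) v (B : R) : (forall y, is_derive y v f (df y)) ->
  (forall y, `|df y| <= B) ->
  forall x (t : R), 0 <= t -> `|f (x + t *: v) - f x| <= B * t.
Proof.
move=> dfv dfB x t t0.
have H s := is_derive_along x s dfv.
have [|s _] := @MVT_segment _ (fun h : R => f (h *: v + x)) _ 0 t t0 (fun s _ => H s).
  apply: continuous_subspaceT; apply: derivable1_continuous => s.
  by have [] := H s.
rewrite scale0r add0r subr0 [x + _]addrC => ->.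
by rewrite normrM (ger0_norm t0) ler_wpM2r.
Qed.

(** Translation invariance makes the integrals of the difference quotients vanish; dominated
    convergence passes this on to the derivative. *)
Lemma Rintegral_partial f i : Cc_infty f -> \int[mu]_x 'D_(e_ i) f x = 0.
Proof.
move=> cf; have cdf := Cc_infty_partial i cf.
have [B B0 dfB] := Cc_infty_bounded cdf.
have /Cc_inftyP[sf [M fM]] := cf.
have if_ := Cc_infty_integrable cf.
pose v := e_ i.
have dfv y : is_derive y v f ('D_v f y) by exact: smooth_is_derive.
pose u m x := m.+1%:R * (f (x + m.+1%:R^-1 *: v) - f x).
have m0 m : 0 < m.+1%:R^-1 :> R by rewrite invr_gt0.
have is_ m : mu.-integrable setT (EFin \o (fun x => f (x + m.+1%:R^-1 *: v))).
  exact: (integrable_shift (m.+1%:R^-1 *: v) if_).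
have iw m : mu.-integrable setT (EFin \o (fun x => f (x + m.+1%:R^-1 *: v) - f x)).
  exact: (integrableB measurableT (is_ m) if_).
have iu m : mu.-integrable setT (EFin \o u m).
  exact: (integrableZl measurableT m.+1%:R (iw m)).
have u0 m : (\int[mu]_x (u m x)%:E = 0)%E.
  rewrite -[LHS]fineK; last exact: (integrable_fin_num measurableT (iu m)).
  congr EFin; rewrite -/(Rintegral _ _ _) /u (RintegralZl _ measurableT (iw m)).
  by rewrite (RintegralB measurableT (is_ m) if_) (Rintegral_shift _ if_) subrr mulr0.
(* The steps have length at most |v|, so every [u m] vanishes outside [cball N] and is dominated by
   [B] times the indicator of this ball. *)
pose N := M + `|v|.
have cvgu x : (u m x)%:E @[m --> \oo] --> ('D_v f x)%:E.
  apply: cvg_EFin; first by apply: nearW.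
  have := dfv x => /is_derive_line[/= H E].
  have := H; rewrite /derivable => /cvg_ex[l Hl].
  have lE : l = 'D_v f x by rewrite -E; apply/esym/cvg_lim.
  rewrite lE in Hl; move/(cvgr_dnbhsP _ _ _): Hl => /(_ (fun m => m.+1%:R^-1)).
  have h : (forall m, m.+1%:R^-1 != 0 :> R) /\ m.+1%:R^-1 @[m --> \oo] --> (0 : R).
    split; first by move=> m; rewrite gt_eqF.
    exact: cvg_harmonic.
  move=> /(_ h); apply: cvg_trans; apply: near_eq_cvg; near=> m.
  rewrite /u /= addr0 scale0r add0r invrK.
 by rewrite [_%:A]mulr1 [x + _]addrC.
have ub m x : `|u m x| <= B * \1_(cball N) x.
  rewrite indicE; case: (pselect (cball N x)) => xN.
    rewrite mem_set// mulr1 /u normrM ger0_norm// mulrC -ler_pdivlMr//.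
    exact: (increment_le dfv dfB).
  rewrite memNset// mulr0 /u (fM x) ?fM ?subrr ?mulr0 ?normr0//.
    have := notin_cball xN; rewrite /N.
    have : `|m.+1%:R^-1 *: v| <= `|v|.
      by rewrite normrZ ger0_norm ?ler_piMl// ?invf_le1 ?ler1n// ltW.
    have := ler_normB (x + m.+1%:R^-1 *: v) (m.+1%:R^-1 *: v); rewrite addrK; lra.
  have := notin_cball xN; rewrite /N; have := normr_ge0 v; lra.
have mf := continuous_measurable_rV (smooth_continuous sf).
have cvgI := @dominated_cvg _ _ _ mu setT measurableT (fun m x => (u m x)%:E)
  (fun x => ('D_v f x)%:E) (fun x => (B * \1_(cball N) x)%:E).
have -> : \int[mu]_x 'D_(e_ i) f x = fine (\int[mu]_x ('D_v f x)%:E)%E by [].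
suff -> : (\int[mu]_x ('D_v f x)%:E = 0)%E by [].
apply: (cvg_unique _ (cvgI _ _ _ _ _)) => //.
- by move=> m; apply/measurable_int/(iu m).
- apply: (@integrable_bounded_support _ N B).
  + by apply: measurable_funM => //; apply: measurable_indic; exact: measurable_cball.
  + move=> x; rewrite normrM (ger0_norm B0) ler_piMr// indicE.
    by case: (_ \in _); rewrite ?normr1 ?normr0.
  + move=> x Nx; rewrite indicE memNset ?mulr0//= => ?.
    by move: Nx; rewrite ltNge => /negP.
- by move=> m x _; rewrite lee_fin.
- by apply: cvg_near_cst; apply: nearW => m; exact: u0.
Unshelve. all: by end_near. Qed.

Definition grad f x : V := \row_i 'D_(e_ i) f x.

(** Integration by parts: the partial derivative of the product [f * phi] integrates to 0. *)
Lemma Cc_infty_weak_gradient f : Cc_infty f -> is_weak_gradient f (grad f).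
Proof.
move=> cf; split; first exact: Cc_infty_locally_integrable.
  move=> i; under eq_fun do rewrite mxE.
  exact/Cc_infty_locally_integrable/Cc_infty_partial.
move=> phi i cphi.
have cdf := Cc_infty_partial i cf; have cdphi := Cc_infty_partial i cphi.
have H1 : mu.-integrable setT (EFin \o (fun x => f x * 'D_(e_ i) phi x)).
  by apply: Cc_infty_integrable; apply: Cc_inftyM => //; exact: Cc_infty_smooth.
have H2 : mu.-integrable setT (EFin \o (fun x => phi x * 'D_(e_ i) f x)).
  by apply: Cc_infty_integrable; apply: Cc_inftyM => //; exact: Cc_infty_smooth.
have := Rintegral_partial i (Cc_inftyM (Cc_infty_smooth cf) cphi).
rewrite (_ : (fun x => 'D_(e_ i) (f * phi) x) =
  (fun x => f x * 'D_(e_ i) phi x + phi x * 'D_(e_ i) f x)); last first.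
  apply/funext => x; apply: derive_val.
  by apply: is_deriveM; exact: (smooth_is_derive _ _ (Cc_infty_smooth _)).
rewrite RintegralD// => /eqP; rewrite addr_eq0 => /eqP ->; congr (- _).
by apply: eq_Rintegral => x _; rewrite mxE mulrC.
Qed.

Lemma locally_integrableB d g : locally_integrable_rV d -> locally_integrable_rV g ->
  locally_integrable_rV (fun x => d x - g x).
Proof.
move=> [md di] [mg gi]; split; first exact: measurable_funB.
move=> C cC; apply: (integrableB (compact_measurable_rV cC) (di _ cC) (gi _ cC)).
Qed.

Lemma cube_sub_cball k : @cube R n k `<=` cball k%:R.
Proof.
move=> x xk; rewrite /cball /= [leLHS]mx_normrE; apply/bigmax_leP; split=> // -[i0 i] _.
rewrite ord1 /=; have := xk i; rewrite !mxE /= in_itv /= => /andP[? ?].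
by rewrite ler_norml; apply/andP; split => //; exact: ltW.
Qed.

Lemma integral_box_eq0 d : locally_integrable_rV d ->
  (forall phi, Cc_infty phi -> \int[mu]_x (d x * phi x) = 0) ->
  forall a b, (\int[mu]_(x in box a b) (d x)%:E = 0)%E.
Proof.
move=> ld d0 a b; have [md di] := ld.
have [chi [cchi chi01 [M chiM] chilim]] := box_test_fun a b.
have mbox := @measurable_box R n a b.
rewrite integral_mkcond.
have -> : ((fun x => (d x)%:E) \_ (box a b)) = (fun x => (d x * \1_(box a b) x)%:E).
  apply/funext => x; rewrite patchE indicE; case: ifPn => _; first by rewrite mulr1.
  by rewrite mulr0.
have bchi m x : `|chi m x| <= 1 by have /andP[? ?] := chi01 m x; rewrite ger0_norm.
have ichi m := integrable_locally_bounded ld (Cc_infty_measurable (cchi m)) (bchi m) (chiM m).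
have cvgI := @dominated_cvg _ _ _ mu setT measurableT (fun m x => (d x * chi m x)%:E)
  (fun x => (d x * \1_(box a b) x)%:E) (fun x => `|(d x * \1_(cball M) x)%:E|%E).
apply: (cvg_unique _ (cvgI _ _ _ _ _)) => //.
- by move=> m; apply/measurable_int/(ichi m).
- by move=> x _; apply: cvg_EFin; [exact: nearW|apply: cvgMr; exact: chilim].
- apply: integrable_abse; apply: (@integrable_locally_bounded _ _ M 1) => //.
  + by apply: measurable_indic; exact: measurable_cball.
  + by move=> x; rewrite indicE; case: (_ \in _); rewrite ?normr1 ?normr0.
  + move=> x Nx; rewrite indicE memNset//= => ?.
    by move: Nx; rewrite ltNge => /negP.
- move=> m x _; rewrite lee_fin !normrM ler_wpM2l//.
  have [/notin_cball /chiM ->|] := pselect (~ cball M x); first by rewrite normr0.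
  by move=> /contrapT xM; rewrite [X in _ <= `|X|]indicE mem_set//= normr1.
- have z m : (\int[mu]_x (d x * chi m x)%:E = 0)%E.
    rewrite -[LHS]fineK; last exact: (integrable_fin_num measurableT (ichi m)).
    by congr EFin; exact: d0.
  by apply: cvg_near_cst; apply: nearW => m; exact: z.
Qed.

(** The fundamental lemma of the calculus of variations: testing against approximate indicators
    gives integral 0 on boxes, hence on all measurable subsets of a cube, hence [d] vanishes almost
    everywhere there. *)
Lemma weak_null d : locally_integrable_rV d ->
  (forall phi, Cc_infty phi -> \int[mu]_x (d x * phi x) = 0) ->
  {ae mu, forall x, d x = 0}.
Proof.
move=> ld d0; have box0 := integral_box_eq0 ld d0; have [md di] := ld.
have mc k : measurable (cube k : set V) by exact: measurable_box.
have ic k : mu.-integrable (cube k) (EFin \o d).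
  apply: (integrableS _ _ (@cube_sub_cball k) (di _ (@cball_compact _))) => //.
  exact: measurable_cball.
have key k A : measurable A -> (\int[mu]_(x in cube k `&` A) (d x)%:E = 0)%E.
  rewrite measurable_boxes.
  have iA B : measurable B -> mu.-integrable (cube k `&` B) (EFin \o d).
    by move=> mB; apply: (integrableS _ _ _ (ic k)) => //; exact: measurableI.
  (* Intersecting with [cube k] makes [d] integrable, so complements are treated by subtraction and
     disjoint unions by summation. *)
  apply: (@dynkin_induction _ _ boxes (fun A => \int[mu]_(x in cube k `&` A) (d x)%:E = 0)%E).
  - exact: measurable_boxes.
  - exact: boxes_setI.
  - by rewrite setIT; exact: box0.
  - move=> _ [[a b] _ <-].
    by have [[a' b'] _ <-] := boxes_setI (box_boxes (const_mx (- k%:R)) (const_mx k%:R)) (box_boxes a b); exact: box0.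
  - move=> S mS S0; have := box0 (const_mx (- k%:R)) (const_mx k%:R).
    rewrite -/(cube k) -{1}[cube k](setIT) -(setUv S) setIUr integral_setU.
    + by rewrite S0 add0e.
    + exact: measurableI.
    + by apply: measurableI => //; exact: measurableC.
    + exact/measurable_EFinP/measurable_funTS.
    + by apply/disj_setPS => x [[_ ?] [_ ?]].
  - move=> F mF tF F0; rewrite setI_bigcupr integral_bigcup.
    + by apply: eseries0 => i _ _; exact: F0.
    + exact: trivIset_setIl.
    + by move=> i; exact: measurableI.
    + by rewrite -setI_bigcupr; apply: iA; exact: bigcupT_measurable.
have aek k : ae_eq mu (cube k) (EFin \o d) (cst 0%E).
  apply: integral_ae_eq => // E Ek mE.
  by rewrite integral0 -(setIidr Ek) key.
have : {ae mu, forall x, forall k, cube k x -> (d x)%:E = 0%E}.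
  exact: (ae_foralln (fun k => aek k)).
apply: filterS => x Hx.
have [k _ xk] : (\bigcup_k cube k) x by rewrite bigcup_cube.
by have [] := Hx k xk.
Qed.

(** Lets the arbitrary choice made in [weak_gradient] be replaced by an explicit field under
    integrals. *)
Lemma weak_gradient_ae f (g : V -> V) : is_weak_gradient f g ->
  {ae mu, forall x, weak_gradient f x = g x}.
Proof.
move=> wg.
have [lf lw ww] : is_weak_gradient f (weak_gradient f).
  by apply: (@xgetPex _ (fun=> 0) [set g | is_weak_gradient f g]); exists g.
have [_ lg gg] := wg.
have : {ae mu, forall x, forall i, weak_gradient f x ord0 i - g x ord0 i = 0}.
  apply: filter_forall => i.
  apply: weak_null => [|phi cphi].
    exact: locally_integrableB.
  have [B _ phiB] := Cc_infty_bounded cphi; have /Cc_inftyP[_ [M phiM]] := cphi.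
  have mphi := Cc_infty_measurable cphi.
  have i1 := integrable_locally_bounded (lw i) mphi phiB phiM.
  have i2 := integrable_locally_bounded (lg i) mphi phiB phiM.
  under eq_Rintegral do rewrite mulrBl.
  rewrite RintegralB//; apply/eqP; rewrite subr_eq0; apply/eqP.
  by apply: oppr_inj; rewrite -ww// -gg.
apply: filterS => x Hx; apply/rowP => i; apply/eqP; rewrite -subr_eq0.
by rewrite Hx.
Qed.

Lemma is_weak_gradientB f g (F G : V -> V) : is_weak_gradient f F ->
  is_weak_gradient g G -> is_weak_gradient (f \- g) (fun x => F x - G x).
Proof.
move=> [lf lF fF] [lg lG gG]; split; first exact: locally_integrableB.
  by move=> i; under eq_fun do rewrite !mxE; exact: locally_integrableB.
move=> phi i cphi; have cd := Cc_infty_partial i cphi.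
have [B _ phiB] := Cc_infty_bounded cphi; have /Cc_inftyP[_ [M phiM]] := cphi.
have mphi := Cc_infty_measurable cphi.
have [B' _ phiB'] := Cc_infty_bounded cd; have /Cc_inftyP[_ [M' phiM']] := cd.
have mphi' := Cc_infty_measurable cd.
have i1 := integrable_locally_bounded lf mphi' phiB' phiM'.
have i2 := integrable_locally_bounded lg mphi' phiB' phiM'.
have i3 := integrable_locally_bounded (lF i) mphi phiB phiM.
have i4 := integrable_locally_bounded (lG i) mphi phiB phiM.
under eq_Rintegral do rewrite mulrBl.
rewrite RintegralB// fF// gG//.
under [in RHS]eq_Rintegral do rewrite !mxE mulrBl.
by rewrite RintegralB// opprB opprK addrC.
Qed.

End weak.

(** * The seminorms N_u *)

Section varphi_norm.
Context {R : realType} {n : nat}.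
Variables (p tau : R).
Hypotheses (p1 : 1 <= p) (tau1 : -1 <= tau <= 1).
Local Notation V := 'rV[R]_n.
Local Notation mu := (@lebesgue_rV R n).
Local Notation e_ i := (delta_mx ord0 i : V).
Local Notation vphi := (varphi p tau).
Implicit Types (F G : V -> R) (u x c : V).

Let p0 : 0 < p. Proof. exact: lt_le_trans ltr01 p1. Qed.

Let ca := ((1 + tau) / 2) `^ p^-1.
Let cb := ((1 - tau) / 2) `^ p^-1.

Let ca0 : 0 <= ca. Proof. exact: powR_ge0. Qed.
Let cb0 : 0 <= cb. Proof. exact: powR_ge0. Qed.

Let coef_le1 (t : R) : 0 <= t <= 1 -> t `^ p^-1 <= 1.
Proof.
move=> /andP[t0 t1]; apply: (@le_trans _ _ (1 `^ p^-1)); last by rewrite powR1.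
rewrite ge0_ler_powR ?nnegrE//.
by rewrite invr_ge0 ltW.
Qed.

Let ca1 : ca <= 1.
Proof. by move: tau1 => /andP[? ?]; apply: coef_le1; apply/andP; split; lra. Qed.
Let cb1 : cb <= 1.
Proof. by move: tau1 => /andP[? ?]; apply: coef_le1; apply/andP; split; lra. Qed.

Lemma varphi_ge0 t : 0 <= vphi t.
Proof. by rewrite /varphi addr_ge0// mulr_ge0// ?powR_ge0// le_max lexx orbT. Qed.

Let varphiE (t : R) : vphi t = if 0 <= t then ca * t else cb * - t.
Proof.
rewrite /varphi -/ca -/cb; case: ifPn => [t0|].
  by rewrite max_l// max_r ?oppr_le0// mulr0 addr0.
by rewrite -ltNge => t0; rewrite max_r ?(ltW t0)// max_l ?oppr_ge0 ?(ltW t0)// mulr0 add0r.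
Qed.

(** [varphi] is linear on each half-line, with a slope <= 0 on the left and >= 0 on the right; it is
    thus convex and positively homogeneous, hence subadditive. *)
Lemma varphiD s t : vphi (s + t) <= vphi s + vphi t.
Proof.
have P (x : R) : 0 <= x -> 0 <= ca * x /\ 0 <= cb * x by move=> x0; rewrite !mulr_ge0.
have N (x : R) : x < 0 -> ca * x <= 0 /\ cb * x <= 0.
  by move=> /ltW x0; rewrite !mulr_ge0_le0.
rewrite !varphiE; case: (lerP 0 s) => [/[dup] s0 /P[? ?]|/[dup] s0 /N[? ?]];
  case: (lerP 0 t) => [/[dup] t0 /P[? ?]|/[dup] t0 /N[? ?]];
  case: (lerP 0 (s + t)) => st0; lra.
Qed.

Lemma varphiZ k t : 0 <= k -> vphi (k * t) = k * vphi t.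
Proof.
rewrite le_eqVlt => /predU1P[<-|k0].
  by rewrite !mul0r varphiE lexx mulr0.
rewrite !varphiE pmulr_rge0//; case: ifP => _; first by rewrite mulrCA.
by rewrite -mulrN mulrCA.
Qed.

Lemma varphi_le_norm t : vphi t <= `|t|.
Proof.
rewrite varphiE; case: (lerP 0 t) => t0; first by rewrite ger0_norm ?ler_piMl.
by rewrite ltr0_norm// ler_piMl// oppr_ge0 ltW.
Qed.

Lemma measurable_varphi : measurable_fun setT vphi.
Proof.
by apply: measurable_funD; apply: measurable_funM => //; apply: measurable_maxr.
Qed.

Lemma dotpDr u x c : dotp u (x + c) = dotp u x + dotp u c.
Proof. by rewrite /dotp -big_split; apply: eq_bigr => i _; rewrite mxE mulrDr. Qed.

Lemma dotpZr u (k : R) x : dotp u (k *: x) = k * dotp u x.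
Proof. by rewrite /dotp mulr_sumr; apply: eq_bigr => i _; rewrite mxE mulrCA. Qed.

(** Pythagoras: for unit [u] and [s = dotp u x], the squared length of [x - s u] is
    [dotp x x - s ^+ 2]. *)
Lemma dotp_le_enorm u x : enorm u = 1 -> `|dotp u x| <= enorm x.
Proof.
move=> u1; rewrite /enorm -sqrtr_sqr ler_wsqrtr//.
have uu : dotp u u = 1.
  have d0 : 0 <= dotp u u by apply: sumr_ge0 => i _; rewrite -expr2 sqr_ge0.
  by rewrite -(sqr_sqrtr d0) -/(enorm u) u1 expr1n.
move: (erefl (dotp u x)); move: {2 3}(dotp u x) => s sE.
suff : 0 <= dotp x x - s ^+ 2 by rewrite subr_ge0.
have -> : dotp x x - s ^+ 2 = \sum_(i < n) (x ord0 i - s * u ord0 i) ^+ 2.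
  transitivity (dotp x x - 2 * s * s + s ^+ 2 * dotp u u); first by rewrite uu; ring.
  rewrite -{2}sE /dotp !mulr_sumr -sumrB -big_split; apply: eq_bigr => i _ /=.
  by ring.
by apply: sumr_ge0 => i _; exact: sqr_ge0.
Qed.

Definition mnorm F : \bar R := 'N[mu]_p%:E[EFin \o F]%E.

Lemma mnormE F : mnorm F = ((\int[mu]_x (`|F x| `^ p)%:E) `^ p^-1)%E.
Proof.
rewrite /mnorm unlock; congr (_ `^ _)%E; exact: eq_integral.
Qed.

Lemma measurable_norm_powR F : measurable_fun setT F ->
  measurable_fun setT (fun x => (`|F x| `^ p)%:E).
Proof.
move=> mF; apply/measurable_EFinP.
apply: (@measurableT_comp _ _ _ _ _ _ (@powR R ^~ p)) => //.
exact: measurableT_comp.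
Qed.

Lemma integral_norm_powR_ge0 F : (0 <= \int[mu]_x (`|F x| `^ p)%:E)%E.
Proof. by apply: integral_ge0 => x _; rewrite lee_fin powR_ge0. Qed.

Lemma lee_poweR (r : R) : 0 <= r -> forall s t : \bar R, (0 <= s)%E -> (s <= t)%E ->
  (s `^ r <= t `^ r)%E.
Proof.
move=> r0 s t s0 st; apply: gt0_ler_poweR => //; rewrite in_itv /= leey andbT//.
exact: le_trans st.
Qed.

Lemma mnorm_le F G : measurable_fun setT F -> measurable_fun setT G ->
  (forall x, `|F x| <= `|G x|) -> (mnorm F <= mnorm G)%E.
Proof.
move=> mF mG FG; rewrite (mnormE F) (mnormE G).
apply: lee_poweR; [by rewrite invr_ge0 ltW|exact: integral_norm_powR_ge0|].
apply: ge0_le_integral => //.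
- exact: measurable_norm_powR.
- exact: measurable_norm_powR.
- by move=> x _; rewrite lee_fin ge0_ler_powR ?nnegrE// ltW.
Qed.

Lemma mnormZ (k : R) F : measurable_fun setT F -> 0 <= k ->
  mnorm (fun x => k * F x) = (k%:E * mnorm F)%E.
Proof.
move=> mF k0; rewrite !mnormE.
under eq_integral do rewrite normrM (ger0_norm k0) powRM// EFinM.
rewrite ge0_integralZl//; last 2 first.
  exact: measurable_norm_powR.
  by rewrite lee_fin powR_ge0.
rewrite poweRM ?integral_norm_powR_ge0//; last by rewrite lee_fin powR_ge0.
by rewrite poweR_EFin -powRrM divff ?gt_eqF// powRr1.
Qed.

Lemma mnorm_shift F c : measurable_fun setT F ->
  mnorm (fun x => F (x + c)) = mnorm F.
Proof.
move=> mF; rewrite (mnormE F) (mnormE (fun x => F (x + c))).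
apply: (congr1 (fun z => z `^ p^-1)%E).
apply: (@ge0_integral_shift _ _ (fun x => (`|F x| `^ p)%:E)).
  exact: measurable_norm_powR.
by move=> x; rewrite lee_fin powR_ge0.
Qed.

Lemma mnorm_ae F G : measurable_fun setT F -> measurable_fun setT G ->
  {ae mu, forall x, F x = G x} -> mnorm F = mnorm G.
Proof.
move=> mF mG FG; rewrite (mnormE F) (mnormE G); apply: (congr1 (fun z => z `^ p^-1)%E).
apply: ae_eq_integral => //; [exact: measurable_norm_powR|exact: measurable_norm_powR|].
by apply: filterS FG => x -> _.
Qed.

Lemma mnorm_ge0 F : (0 <= mnorm F)%E. Proof. exact: Lnorm_ge0. Qed.

Definition mfield (X : V -> V) := forall i, measurable_fun setT (fun x => X x ord0 i).

Lemma measurable_mfield X : mfield X -> measurable_fun setT X.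
Proof. exact: measurable_fun_rV. Qed.

Lemma measurable_dotp u X : mfield X -> measurable_fun setT (fun x => dotp u (X x)).
Proof. by move=> mX; apply: measurable_sum => i; apply: measurable_funM. Qed.

Lemma measurable_varphi_dotp u X : mfield X ->
  measurable_fun setT (fun x => vphi (dotp u (X x))).
Proof.
by move=> mX; apply: measurableT_comp measurable_varphi _; exact: measurable_dotp.
Qed.

(** Defined on vector fields so that classical gradients, weak gradients and their differences are
    treated alike. *)
Definition Nphi (X : V -> V) u := mnorm (fun x => vphi (dotp u (X x))).

Lemma Nphi_ge0 X u : (0 <= Nphi X u)%E. Proof. exact: mnorm_ge0. Qed.

Lemma Nphi_ae X Y u : mfield X -> mfield Y -> {ae mu, forall x, X x = Y x} ->
  Nphi X u = Nphi Y u.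
Proof.
move=> mX mY XY; apply: mnorm_ae; try exact: measurable_varphi_dotp.
by apply: filterS XY => x ->.
Qed.

Lemma mfieldB X Y : mfield X -> mfield Y -> mfield (fun x => X x - Y x).
Proof.
by move=> mX mY i; under eq_fun do rewrite !mxE; exact: measurable_funB.
Qed.

Lemma measurable_enorm_field X : mfield X -> measurable_fun setT (enorm \o X).
Proof.
move=> mX; apply: measurableT_comp; first exact: measurable_enorm.
exact: measurable_mfield.
Qed.

Lemma Nphi_le_enorm X u : mfield X -> enorm u = 1 -> (Nphi X u <= mnorm (enorm \o X))%E.
Proof.
move=> mX u1; apply: mnorm_le.
- exact: measurable_varphi_dotp.
- exact: measurable_enorm_field.
- move=> x; rewrite ger0_norm ?varphi_ge0// (le_trans (varphi_le_norm _))//.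
  by rewrite (le_trans (dotp_le_enorm _ u1))// ler_norm.
Qed.

(** The order in [X x - Y x] matters, since [varphi] need not be even. *)
Lemma Nphi_triangle X Y u : mfield X -> mfield Y ->
  (Nphi X u <= Nphi Y u + Nphi (fun x => X x - Y x)%R u)%E.
Proof.
move=> mX mY; apply: le_trans (minkowski_EFin mu (measurable_varphi_dotp u mY)
  (measurable_varphi_dotp u (mfieldB mX mY)) p1).
apply: mnorm_le.
- exact: measurable_varphi_dotp.
- by apply: measurable_funD; apply: measurable_varphi_dotp => //; exact: mfieldB.
- move=> x /=; rewrite ger0_norm ?varphi_ge0// ger0_norm ?(addr_ge0 (varphi_ge0 _) (varphi_ge0 _))//.
  have E : X x = Y x + (X x - Y x) by rewrite addrC subrK.
  by rewrite {1}E dotpDr varphiD.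
Qed.

Lemma mfield_grad (f : V -> R) : Cc_infty f -> mfield (grad f).
Proof.
move=> cf i; under eq_fun do rewrite mxE.
by apply: Cc_infty_measurable; exact: Cc_infty_partial.
Qed.

Lemma gradE (f : V -> R) x i df : is_derive x (e_ i) f df -> grad f x ord0 i = df.
Proof. by move=> H; rewrite mxE; exact: derive_val. Qed.

Lemma Nphi_convex (f g : V -> R) (t : R) u : Cc_infty f -> Cc_infty g -> 0 <= t <= 1 ->
  (Nphi (grad (fun x => t * f x + (1 - t) * g x)%R) u <=
   t%:E * Nphi (grad f) u + (1 - t)%:E * Nphi (grad g) u)%E.
Proof.
move=> cf cg /andP[t0 t1]; have t1' : 0 <= 1 - t by rewrite subr_ge0.
have mf := measurable_varphi_dotp u (mfield_grad cf).
have mg := measurable_varphi_dotp u (mfield_grad cg).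
have mtf : measurable_fun setT (fun x => t * vphi (dotp u (grad f x))).
  exact: (measurable_funM (measurable_cst t) mf).
have mtg : measurable_fun setT (fun x => (1 - t) * vphi (dotp u (grad g x))).
  exact: (measurable_funM (measurable_cst (1 - t)) mg).
rewrite /Nphi -(mnormZ mf t0) -(mnormZ mg t1').
apply: le_trans (minkowski_EFin mu mtf mtg p1).
have cfg : Cc_infty (fun x => t * f x + (1 - t) * g x).
  exact: (Cc_inftyD (Cc_inftyZ t cf) (Cc_inftyZ (1 - t) cg)).
apply: mnorm_le.
- by apply: measurable_varphi_dotp; exact: mfield_grad.
- exact: (measurable_funD mtf mtg).
- move=> x /=; rewrite ger0_norm ?varphi_ge0// ger0_norm; last first.
    exact: (addr_ge0 (mulr_ge0 t0 (varphi_ge0 _)) (mulr_ge0 t1' (varphi_ge0 _))).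
  rewrite -!varphiZ// -!dotpZr (le_trans _ (varphiD _ _))// -dotpDr.
  rewrite (_ : grad _ x = t *: grad f x + (1 - t) *: grad g x)//.
  apply/rowP => i.
  have d1 := is_deriveZ t (smooth_is_derive i x (Cc_infty_smooth cf)).
  have d2 := is_deriveZ (1 - t) (smooth_is_derive i x (Cc_infty_smooth cg)).
  by rewrite (gradE (is_deriveD d1 d2)) !mxE.
Qed.

Lemma Nphi_shift (f : V -> R) c u : Cc_infty f ->
  Nphi (grad (fun x => f (x + c))) u = Nphi (grad f) u.
Proof.
move=> cf; rewrite /Nphi -(mnorm_shift c (measurable_varphi_dotp u (mfield_grad cf))).
apply: (congr1 mnorm); apply/funext => x; apply: (congr1 (fun v => vphi (dotp u v))).
apply/rowP => i.
have d := is_derive_shift_rV (smooth_is_derive i (x + c) (Cc_infty_smooth cf)).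
by rewrite (gradE d) mxE.
Qed.

(** The chain rule multiplies the gradient by T'(f), and [varphi] lets this factor out because it is
    nonnegative. *)
Lemma Nphi_comp (f : V -> R) (T : R -> R) (k : R) u : Cc_infty f -> smooth1 T -> T 0 = 0 ->
  (forall t, 0 <= (T^`())%classic t <= k) ->
  (Nphi (grad (T \o f)) u <= k%:E * Nphi (grad f) u)%E.
Proof.
move=> cf sT T0 Tk.
have k0 : 0 <= k by have /andP[] := Tk 0; exact: le_trans.
have mf := measurable_varphi_dotp u (mfield_grad cf).
rewrite /Nphi -mnormZ//; apply: mnorm_le.
- by apply: measurable_varphi_dotp; apply: mfield_grad; exact: Cc_infty_comp.
- exact: measurable_funM.
- move=> x; rewrite ger0_norm ?varphi_ge0// ger0_norm ?(mulr_ge0 k0 (varphi_ge0 _))//.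
  have /andP[T'0 T'k] := Tk (f x).
  rewrite (_ : grad _ x = (T^`())%classic (f x) *: grad f x).
    by rewrite dotpZr varphiZ// ler_wpM2r ?varphi_ge0.
  apply/rowP => i.
  have d := is_derive_comp1 (smooth1_is_derive (f x) sT) (smooth_is_derive i x (Cc_infty_smooth cf)).
  by rewrite (gradE d) !mxE.
Qed.

Lemma mfield_weak_gradient f : (exists g, is_weak_gradient f g) ->
  mfield (weak_gradient f).
Proof.
move=> wf.
have [_ H _] : is_weak_gradient f (weak_gradient f).
  exact: (@xgetPex _ (fun=> 0) [set g | is_weak_gradient f g]).
by move=> i; have [] := H i.
Qed.

Lemma Nphi_weak_gradient f u : Cc_infty f ->
  Nphi (weak_gradient f) u = Nphi (grad f) u.
Proof.
move=> cf; have wf := Cc_infty_weak_gradient cf.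
apply: Nphi_ae; [|exact: mfield_grad|exact: weak_gradient_ae].
by apply: mfield_weak_gradient; exists (grad f).
Qed.

(** On the unit sphere [Nphi] is dominated by the norm of the gradient in L^p, so one approximation
    works for all directions. *)
Lemma Nphi_approx f phi u (e : R) : sobolev p f -> Cc_infty phi ->
  (sobolev_norm p (f \- phi)%R < e%:E)%E -> enorm u = 1 ->
  (Nphi (grad phi) u <= Nphi (weak_gradient f) u + e%:E)%E.
Proof.
move=> [mf [g wg] _] cphi fe u1.
have wf : is_weak_gradient f (weak_gradient f).
  by apply: (@xgetPex _ (fun=> 0) [set g | is_weak_gradient f g]); exists g.
have mwf := mfield_weak_gradient (ex_intro _ g wg).
have wB := is_weak_gradientB wf (Cc_infty_weak_gradient cphi).
have aeB := weak_gradient_ae wB.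
have mwB := mfield_weak_gradient (ex_intro _ _ wB).
have mg := mfield_grad cphi.
apply: (le_trans (Nphi_triangle u mg mwf)); rewrite leeD2l//.
apply: (le_trans (Nphi_le_enorm (mfieldB mg mwf) u1)).
rewrite (@mnorm_ae _ (enorm \o weak_gradient (f \- phi))).
- apply: le_trans (ltW fe); rewrite /sobolev_norm leeDr// Lnorm_ge0//.
- by apply: measurable_enorm_field; exact: mfieldB.
- exact: measurable_enorm_field.
- apply: filterS aeB => x /= ->; rewrite /enorm /dotp; congr Num.sqrt.
  by apply: eq_bigr => i _; rewrite !mxE; ring.
Qed.

Lemma Nphi_fin f u : sobolev p f -> enorm u = 1 -> Nphi (weak_gradient f) u \is a fin_num.
Proof.
move=> [_ wg fo] u1; rewrite ge0_fin_numE ?Nphi_ge0//.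
apply: le_lt_trans (Nphi_le_enorm (mfield_weak_gradient wg) u1) _.
by apply: le_lt_trans fo; rewrite /sobolev_norm leeDr// Lnorm_ge0.
Qed.

(** Tonelli's theorem, the integrand being jointly measurable in (u, x). *)
Lemma measurable_Nphi X : mfield X -> measurable_fun setT (Nphi X).
Proof.
move=> mX; rewrite (_ : Nphi X = (fun u => (fubini_F mu
   (fun ux : V * V => (`|vphi (dotp ux.1 (X ux.2))| `^ p)%:E) u) `^ p^-1)%E); last first.
  by apply/funext => u; rewrite /Nphi mnormE.
apply: (@measurableT_comp _ _ _ _ _ _ (@poweR R ^~ p^-1)); first exact: measurable_poweR.
apply: measurable_fun_fubini_tonelli_F; last by move=> x; rewrite lee_fin powR_ge0.
apply/measurable_EFinP.
apply: (@measurableT_comp _ _ _ _ _ _ (@powR R ^~ p)) => //.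
apply: measurableT_comp => //; apply: measurableT_comp measurable_varphi _.
apply: measurable_sum => i; apply: measurable_funM.
  exact: (measurableT_comp (measurable_coord_rV i) measurable_fst).
exact: (measurableT_comp (mX i) measurable_snd).
Qed.

Lemma energyE f : energy p tau f =
  ((\int[sphere_measure]_(u in sphere) ((Nphi (weak_gradient f) u) `^ n%:R)^-1) `^ (p / n%:R))^-1%E.
Proof.
rewrite /energy; apply: (congr1 (fun z => ((z `^ (p / n%:R))^-1)%E)).
apply: eq_integral => u _; apply: (congr1 (fun z => (z^-1)%E)).
rewrite /Nphi mnormE mulrC poweRrM; apply: (congr1 (fun z => ((z `^ p^-1) `^ n%:R)%E)).
by apply: eq_integral => x _; rewrite ger0_norm// varphi_ge0.
Qed.

End varphi_norm.

(** * Semicontinuity of the energy *)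

(* No measurability is assumed, contrary to [ge0_le_integral]: this avoids proving that
   the inverse is measurable on the extended reals. *)
Lemma ge0_integral_mono d (T : measurableType d) (R : realType)
    (m : {measure set T -> \bar R}) (D : set T) (f g : T -> \bar R) :
  (forall x, D x -> 0 <= f x)%E -> (forall x, D x -> f x <= g x)%E ->
  (\int[m]_(x in D) f x <= \int[m]_(x in D) g x)%E.
Proof.
move=> f0 fg; have g0 x : D x -> (0 <= g x)%E.
  by move=> Dx; exact: le_trans (f0 x Dx) (fg x Dx).
rewrite !ge0_integralE//; apply: le_ereal_sup => _ [h hf <-]; exists h => // x.
apply: le_trans (hf x) _; rewrite !patchE; case: ifPn => // xD.
by apply: fg; rewrite inE in xD.
Qed.

Section energy_limit.
Context {R : realType} {n : nat}.
Variables (p tau : R).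
Hypotheses (p1 : 1 <= p) (pn : p < n%:R) (tau1 : -1 <= tau <= 1).
Local Notation V := 'rV[R]_n.
Local Notation mu := (@lebesgue_rV R n).
Local Notation N f u := (Nphi p tau (weak_gradient f) u).

Lemma measurable_sphere : measurable (@sphere R n).
Proof.
rewrite (_ : sphere = enorm @^-1` [set 1]).
  by rewrite -[X in measurable X]setTI; exact: measurable_enorm.
by apply/seteqP; split.
Qed.

Lemma energy_ge0 (f : V -> R) : (0 <= energy p tau f)%E.
Proof. by rewrite /energy inve_ge0 poweR_ge0. Qed.

(** The integrands for [g m] are bounded below by the functions [J m], finite and increasing in [m],
    whose limit dominates the integrand [J'] of [f], even where [J'] is infinite. *)
Lemma energy_limit (f : V -> R) (g : nat -> V -> R) (eps : R) : sobolev p f ->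
  (forall m u, enorm u = 1 ->
     (N (g m) u <= (1 + m.+1%:R^-1)%:E * (N f u + m.+1%:R^-1%:E))%E) ->
  (energy p tau f < +oo)%E -> 0 < eps ->
  exists m, (energy p tau (g m) <= energy p tau f + eps%:E)%E.
Proof.
move=> sf gf Ef eps0.
have p0 : 0 < p := lt_le_trans ltr01 p1.
have n0 : 0 < n%:R :> R := lt_trans p0 pn.
pose e m : R := m.+1%:R^-1.
have e0 m : 0 < e m by rewrite invr_gt0.
pose r u := fine (N f u).
have r0 u : 0 <= r u by rewrite fine_ge0// Nphi_ge0.
have Nr u : enorm u = 1 -> N f u = (r u)%:E.
  by move=> u1; rewrite fineK//; exact: Nphi_fin.
have mr : measurable_fun setT r.
  apply: measurableT_comp => //; apply: measurable_Nphi => //.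
  by apply: mfield_weak_gradient; case: sf.
pose q m u := ((1 + e m) * (r u + e m)) ^+ n.
have q0 m u : 0 < q m u.
  rewrite exprn_gt0// mulr_gt0//; last by rewrite ltr_wpDl.
  by rewrite addr_gt0.
pose J m u := (q m u)^-1%:E : \bar R.
pose J' u := ((N f u `^ n%:R)^-1)%E.
have mq m : measurable_fun setT (q m).
  apply: (@measurableT_comp _ _ _ _ _ _ (fun x : R => x ^+ n)) => //.
  by apply: measurable_funM => //; exact: measurable_funD.
have mJ m : measurable_fun (@sphere R n) (J m).
  apply: measurable_funTS; apply/measurable_EFinP.
  rewrite (_ : (fun u => _) = (fun u => q m u `^ (-1))); last first.
    by apply/funext => u; rewrite powR_inv1// ltW.
  exact: (@measurableT_comp _ _ _ _ _ _ (@powR R ^~ (-1))).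
have J0 m u : (0 <= J m u)%E by rewrite lee_fin invr_ge0 ltW.
have eS m k : (m <= k)%N -> e k <= e m by move=> mk; rewrite lef_pV2 ?posrE// ler_nat.
have ndJ u : nondecreasing_seq (J^~ u).
  move=> m k mk; rewrite lee_fin lef_pV2 ?posrE//.
  rewrite lerXn2r ?nnegrE ?mulr_ge0 ?addr_ge0 ?(ltW (e0 _))//.
  by rewrite ler_pM ?addr_ge0 ?(ltW (e0 _)) ?lerD2l ?eS.
have Jg m : (\int[sphere_measure]_(u in sphere) J m u <=
    \int[sphere_measure]_(u in sphere) (N (g m) u `^ n%:R)^-1)%E.
  apply: ge0_integral_mono => u u1; first exact: J0.
  have Ng := gf m u u1; rewrite Nr// -EFinD -EFinM -/(e m) in Ng.
  rewrite inve_pge ?inE ?poweR_ge0 ?J0//.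
  apply: (le_trans (lee_poweR _ (Nphi_ge0 _ _ _ _) Ng)); first exact: ltW.
  rewrite poweR_EFin powR_mulrn; last by rewrite mulr_ge0// addr_ge0// ltW.
  by rewrite inver gt_eqF ?invr_gt0// invrK.
(* Inverses are compared: [L^-1] lies below every [q m u], hence below their limit [r u ^+ n]. This
   covers [r u = 0], where [J'] is infinite. *)
have limJ u : sphere u -> (J' u <= limn (J^~ u))%E.
  move=> u1; set L := limn _.
  have JL m : (J m u <= L)%E.
    apply: lime_ge; first exact: ereal_nondecreasing_is_cvgn (ndJ u).
    by exists m => // k mk; exact: ndJ.
  have L0 : (0 <= L)%E by exact: le_trans (J0 0%N u) (JL 0%N).
  have Lq m : (L^-1 <= (q m u)%:E)%E.
    rewrite inve_ple ?inE ?lee_fin ?(ltW (q0 _ _))//.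
    by rewrite inver gt_eqF//; exact: JL.
  rewrite /J' Nr// poweR_EFin powR_mulrn// inve_ple ?inE ?lee_fin ?exprn_ge0//.
  apply/lee_addgt0Pr => y y0.
  have qlim : q m u @[m --> \oo] --> r u ^+ n.
    have H : (1 + e m) * (r u + e m) @[m --> \oo] --> (1 + 0) * (r u + 0).
      by apply: cvgM; apply: cvgD; (exact: cvg_cst || exact: cvg_harmonic).
    rewrite !addr0 mul1r in H.
    exact: (cvg_comp _ _ H (@exprn_continuous _ n (r u))).
  have ry : r u ^+ n < r u ^+ n + y by rewrite ltrDl.
  have [m _ /(_ m (leqnn m))/=] := cvgr_le _ qlim _ ry.
  by move=> qy; apply: le_trans (Lq m) _; rewrite -EFinD lee_fin.
have cvgI := @cvg_monotone_convergence _ _ _ sphere_measure _ measurable_sphere J mJ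
  (fun m u _ => J0 m u) (fun u _ => ndJ u).
(* If all energies exceeded c, the energy of [f] plus [eps], the integrals of the [J m], and by
   monotone convergence that of [J'], would be at most c^(-n/p); the energy of [f] would then be at
   least c. *)
apply: contrapT => /forallNP H.
have E0 := energy_ge0 f.
pose c := fine (energy p tau f) + eps.
have Ec : (energy p tau f + eps%:E)%E = c%:E.
  by rewrite EFinD fineK// ge0_fin_numE.
have c0 : 0 < c by rewrite ltr_wpDl// fine_ge0.
have pn0 : 0 < p / n%:R by rewrite divr_gt0.
pose I m := (\int[sphere_measure]_(u in sphere) J m u)%E.
have I0 m : (0 <= I m)%E by apply: integral_ge0.
have IK m : (I m <= (c^-1 `^ (n%:R / p))%:E)%E.
  have -> : I m = ((I m `^ (p / n%:R)) `^ (n%:R / p))%E.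
    by rewrite -poweRrM mulrA divfK ?gt_eqF// divff ?gt_eqF// poweRe1.
  rewrite -poweR_EFin lee_poweR ?poweR_ge0 ?divr_ge0 ?(ltW p0) ?(ltW n0)//.
  apply: (le_trans (lee_poweR (ltW pn0) (I0 m) (Jg m))).
  have := H m; rewrite Ec => /negP; rewrite -ltNge energyE// => /ltW.
  by rewrite inve_pge ?inE ?poweR_ge0 ?lee_fin ?(ltW c0)// inver gt_eqF.
have limIK : (\int[sphere_measure]_(u in sphere) (limn (J^~ u)) <= (c^-1 `^ (n%:R / p))%:E)%E.
  by apply: (cvge_to_le cvgI); apply: nearW.
have : (c%:E <= energy p tau f)%E.
  rewrite energyE// inve_pge ?inE ?poweR_ge0 ?lee_fin ?(ltW c0)// inver gt_eqF//.
  have -> : c^-1%:E = ((c^-1 `^ (n%:R / p))%:E `^ (p / n%:R))%E.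
    rewrite poweR_EFin -powRrM mulrA divfK ?gt_eqF// divff ?gt_eqF// powRr1//.
    by rewrite invr_ge0 ltW.
  apply: lee_poweR; first exact: ltW.
    by apply: integral_ge0 => u _; rewrite inve_ge0 poweR_ge0.
  apply: le_trans limIK; apply: ge0_integral_mono => u u1; last exact: limJ.
  by rewrite inve_ge0 poweR_ge0.
rewrite -Ec leNgt => /negP; apply.
by rewrite lteDl// ge0_fin_numE.
Qed.

End energy_limit.

(** * Ball averages *)

Section averages.
Context {R : realType} {n : nat}.
Local Notation V := 'rV[R]_n.
Local Notation mu := (@lebesgue_rV R n).
Local Notation e_ i := (delta_mx ord0 i : V).
Implicit Types (f phi : V -> R) (x y c w : V) (r : R) (A : set V).

Lemma coord_le_enorm x i : `|x ord0 i| <= enorm x.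
Proof.
rewrite /enorm -sqrtr_sqr ler_wsqrtr// /dotp (bigD1 i)//= expr2 lerDl.
by apply: sumr_ge0 => j _; rewrite -expr2 sqr_ge0.
Qed.

Lemma norm_le_enorm x : `|x| <= enorm x.
Proof.
rewrite [leLHS]mx_normrE; apply/bigmax_leP; split=> [|[i0 i] _]; first exact: enorm_ge0.
by rewrite ord1; exact: coord_le_enorm.
Qed.

Lemma enorm_lt x (s r : R) : (forall i, `|x ord0 i| <= s) -> 0 < r ->
  n%:R * s ^+ 2 < r ^+ 2 -> enorm x < r.
Proof.
move=> xs r0 sr; rewrite /enorm -(ger0_norm (ltW r0)) -sqrtr_sqr ltr_sqrt ?exprn_gt0//.
apply: le_lt_trans sr; rewrite mulr_natl -[n in leRHS]card_ord -sumr_const.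
apply: ler_sum => i _; rewrite -expr2 -(real_normK (num_real _)).
by rewrite lerXn2r ?nnegrE// (le_trans _ (xs i)).
Qed.

Lemma measurable_eball x r : measurable (eball x r).
Proof.
rewrite (_ : eball x r = (fun y => y + (- x)) @^-1` (enorm @^-1` `]-oo, r[)).
  rewrite -[X in measurable X]setTI; apply: measurable_shift => //.
  by rewrite -[X in measurable X]setTI; exact: (measurable_enorm measurableT (measurable_itv _)).
by apply/seteqP; split => y; rewrite /eball /= in_itv.
Qed.

Lemma eball_sub_cball x r : eball x r `<=` cball (`|x| + r).
Proof.
move=> y /= yx; have := norm_le_enorm (y - x); have := ler_normD (y - x) x.
rewrite subrK; rewrite /cball /=; move: yx; rewrite /eball /=; lra.
Qed.

Lemma eball_shiftE x r : (fun y => y + x) @^-1` (eball x r) = eball 0 r.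
Proof. by apply/seteqP; split => y; rewrite /eball /= addrK subr0. Qed.

Lemma lebesgue_eball x r : mu (eball x r) = mu (eball 0 r).
Proof. by rewrite -(lebesgue_shift x (measurable_eball x r)) eball_shiftE. Qed.

Lemma lebesgue_eball_lty x r : (mu (eball x r) < +oo)%E.
Proof.
apply: le_lt_trans (compact_lebesgue_lty (@cball_compact R n (`|x| + r))).
by apply: le_measure; rewrite ?inE; [exact: measurable_eball|exact: measurable_cball|exact: eball_sub_cball].
Qed.

Definition eball_vol r : R := fine (mu (eball 0 r)).

Lemma eball_volE x r : (mu (eball x r) = (eball_vol r)%:E)%E.
Proof. by rewrite lebesgue_eball fineK// ge0_fin_numE// lebesgue_eball_lty. Qed.

Lemma eball_vol_gt0 r : 0 < r -> 0 < eball_vol r.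
Proof.
move=> r0; rewrite -lte_fin -(eball_volE 0).
(* The cube of half-side [s] fits into the Euclidean ball because n < (n + 1)^2. *)
pose s := r / n.+1%:R.
have s0 : 0 < s by rewrite divr_gt0.
apply: (@lt_le_trans _ _ (mu (box (const_mx (- s)) (const_mx s)))).
  rewrite lebesgue_box prodEFin lte_fin; apply: prodr_gt0 => i _.
  by rewrite !mxE opprK lt_max addr_gt0// orbT.
apply: le_measure; rewrite ?inE; [exact: measurable_box|exact: measurable_eball|].
move=> y ys; rewrite /eball /= subr0; apply: (@enorm_lt _ s) => // [i|].
  have := ys i; rewrite !mxE /= in_itv /= => /andP[? ?].
  by rewrite ler_norml; apply/andP; split => //; exact: ltW.
rewrite /s expr_div_n mulrCA gtr_pMr ?exprn_gt0// ltr_pdivrMr ?exprn_gt0//.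
rewrite mul1r -natrX ltr_nat expnS expn1 mulSn.
exact: leq_addr.
Qed.

Lemma integrable_eball f x r : locally_integrable_rV f ->
  mu.-integrable (eball x r) (EFin \o f).
Proof.
move=> [_ fi]; apply: (integrableS _ _ (@eball_sub_cball x r) (fi _ (@cball_compact _ _ _))).
  exact: measurable_cball.
exact: measurable_eball.
Qed.

Lemma Rintegral_eball f x r : locally_integrable_rV f ->
  \int[mu]_(y in eball x r) f y = \int[mu]_(y in eball 0 r) f (y + x).
Proof.
move=> lf; rewrite Rintegral_mkcond [RHS]Rintegral_mkcond.
have := integrable_eball x r lf => /(integrable_mkcond _ (measurable_eball x r)) H.
rewrite -(@Rintegral_shift _ _ _ x); last first.
  rewrite (_ : _ \o _ = (EFin \o f) \_ (eball x r))//.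
  by apply/funext => y; rewrite /= !patchE; case: ifP.
apply: eq_Rintegral => y _; rewrite !patchE -(eball_shiftE x).
by rewrite (_ : (y + x \in eball x r) = (y \in +%R^~ x @^-1` eball x r)) ?mem_setE//; apply/idP/idP; rewrite !inE.
Qed.

(** The increment [w] is travelled one coordinate at a time, with the mean value theorem on each
    segment. *)
Lemma Cc_infty_lipschitz phi : Cc_infty phi ->
  exists2 L, 0 <= L & forall x w, `|phi (x + w) - phi x| <= L * `|w|.
Proof.
move=> cphi.
have /choice[B HB] i : exists B, 0 <= B /\ forall x, `|'D_(e_ i) phi x| <= B.
  by have [B B0 H] := Cc_infty_bounded (Cc_infty_partial i cphi); exists B.
exists (\sum_(i < n) B i) => [|x w]; first by apply: sumr_ge0 => i _; have [] := HB i.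
have step i y (t : R) : `|phi (y + t *: e_ i) - phi y| <= B i * `|t|.
  have d z := smooth_is_derive i z (Cc_infty_smooth cphi).
  have [_ Bi] := HB i.
  have [t0|t0] := lerP 0 t.
    by rewrite (ger0_norm t0); exact: (increment_le d Bi).
  rewrite (ltr0_norm t0).
  have := increment_le d Bi (y + t *: e_ i) (t := - t).
  rewrite oppr_ge0 => /(_ (ltW t0)); rewrite scaleNr addrK distrC.
  exact.
rewrite {1}(row_sum_delta w) mulr_suml.
elim: (index_enum _) => [|i s IH]; first by rewrite !big_nil addr0 subrr normr0.
rewrite !big_cons [_ *: _ + _]addrC addrA.
set z := x + _ in IH *.
have -> : phi (z + w ord0 i *: e_ i) - phi x =
  (phi (z + w ord0 i *: e_ i) - phi z) + (phi z - phi x) by ring.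
rewrite (le_trans (ler_normD _ _))// lerD//.
rewrite (le_trans (step _ _ _))// ler_wpM2l//; first by have [] := HB i.
exact: mx_norm_coord.
Qed.

(* The set A is split along a finite cover by balls of radius d; the total mass is kept
   as a factor so that null pieces need no special treatment. *)
Lemma riemann_sum phi (C : set (V -> R)) (e : R) (d : R) (s : seq V) :
  Cc_infty phi -> convex_fset C -> (forall y, C (fun x => phi (x + y))) -> 0 <= e ->
  (forall x y y', `|y - y'| <= d -> `|phi (x + y) - phi (x + y')| <= e) ->
  forall A, measurable A -> (mu A < +oo)%E ->
  (forall y, A y -> exists2 c, c \in s & `|c - y| <= d) ->
  exists2 v, C v & forall x,
    `|v x * fine (mu A) - \int[mu]_(y in A) phi (x + y)| <= e * fine (mu A).
Proof.
move=> cphi convC Cphi e0 mod; have [B _ phiB] := Cc_infty_bounded cphi.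
have mphi x : measurable_fun setT (fun y => phi (x + y)).
  by under eq_fun do rewrite addrC; exact: Cc_infty_measurable (Cc_infty_shift x cphi).
have iphi x A : measurable A -> (mu A < +oo)%E ->
    mu.-integrable A (EFin \o (fun y => phi (x + y))).
  move=> mA Aoo; apply: measurable_bounded_integrable => //.
    exact: measurable_funTS.
  exists B; split; first exact: num_real.
  by move=> r Br y _; exact: le_trans (phiB _) (ltW Br).
elim: s => [|c s IH] A mA Aoo cover.
  have -> : A = set0.
    by apply/seteqP; split => // y /cover[].
  exists (fun x => phi (x + 0)); first exact: Cphi.
  by move=> x; rewrite measure0 !mulr0 Rintegral_set0 subrr normr0.
pose b := [set y | `|c - y| <= d].
have mb : measurable b.
  apply: closed_measurable_rV; apply: (@closed_comp _ _ (fun y => `|c - y|) [set r | r <= d]).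
    move=> y _; apply: (@continuous_comp _ _ _ (fun y => c - y) (fun z => `|z|)).
      by apply: continuousB => //; exact: cst_continuous.
    exact: norm_continuous.
  exact: closed_le.
have mA1 : measurable (A `&` b) by exact: measurableI.
have mA2 : measurable (A `\` b) by exact: measurableD.
have lt1 : (mu (A `&` b) < +oo)%E.
  by apply: le_lt_trans Aoo; apply: le_measure; rewrite ?inE//; exact: subIsetl.
have lt2 : (mu (A `\` b) < +oo)%E.
  by apply: le_lt_trans Aoo; apply: le_measure; rewrite ?inE//; exact: subDsetl.
have [v Cv Hv] : exists2 v, C v & forall x,
    `|v x * fine (mu (A `\` b)) - \int[mu]_(y in A `\` b) phi (x + y)| <=
    e * fine (mu (A `\` b)).
  apply: IH => // y [/cover[c']]; rewrite in_cons => /predU1P[->//|sc' yc' _].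
  by exists c'.
have H1 x : `|phi (x + c) * fine (mu (A `&` b)) - \int[mu]_(y in A `&` b) phi (x + y)| <=
    e * fine (mu (A `&` b)).
  have ic k : mu.-integrable (A `&` b) (EFin \o cst k).
    apply: measurable_bounded_integrable => //; exists `|k|; split; first exact: num_real.
    by move=> r kr y _; exact: ltW kr.
  rewrite -Rintegral_cst// -RintegralB//; [|exact: ic|exact: iphi].
  have iB : mu.-integrable (A `&` b) (EFin \o (fun y => phi (x + c) - phi (x + y))).
    exact: (integrableB mA1 (ic _) (iphi x _ mA1 lt1)).
  rewrite (le_trans (le_normr_Rintegral mA1 iB))// -(Rintegral_cst mu mA1).
  apply: le_Rintegral => //; [exact: (integrable_norm iB)|exact: ic|].
  by move=> y [_ yb]; exact: mod.
set m1 := fine (mu (A `&` b)) in H1; set m2 := fine (mu (A `\` b)) in Hv.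
have m10 : 0 <= m1 by exact: fine_ge0.
have m20 : 0 <= m2 by exact: fine_ge0.
have mAE : fine (mu A) = m1 + m2.
  rewrite -fineD ?ge0_fin_numE//; congr fine.
  rewrite -measureU//; last by rewrite setDE setIACA setICr setI0.
  by rewrite setUIDK.
(* The share of the mass of A that lies in [b]. For a null A it is 0, and [tE] still holds since
   [m1] is then 0. *)
pose t := m1 / (m1 + m2).
exists (fun x => t * phi (x + c) + (1 - t) * v x).
  apply: (convC (fun x => phi (x + c)) v) => //.
  rewrite /t divr_ge0 ?addr_ge0//=.
  have [->|m0] := eqVneq (m1 + m2) 0; first by rewrite invr0 mulr0.
  by rewrite ler_pdivrMr ?mul1r ?lerDl// lt_def m0 addr_ge0.
move=> x; have IE : \int[mu]_(y in A) phi (x + y) =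
    \int[mu]_(y in A `&` b) phi (x + y) + \int[mu]_(y in A `\` b) phi (x + y).
  rewrite -[in LHS](setUIDK A b) Rintegral_setU//.
    by rewrite setUIDK; exact: iphi.
  by apply/disj_setPS => y [[_ ?] [_ ?]].
have tE : t * (m1 + m2) = m1.
  rewrite /t; have [m0|m0] := eqVneq (m1 + m2) 0; last by rewrite divfK.
  by rewrite m0 mulr0; lra.
rewrite mAE IE.
have -> : (t * phi (x + c) + (1 - t) * v x) * (m1 + m2) =
  phi (x + c) * m1 + v x * m2.
  rewrite mulrDl mulrAC tE mulrAC mulrBl tE mul1r; ring.
by rewrite opprD addrACA (le_trans (ler_normD _ _))// mulrDr lerD.
Qed.

Lemma ball_averageE phi x r : locally_integrable_rV phi ->
  ball_average phi x r = (eball_vol r)^-1 * \int[mu]_(y in eball 0 r) phi (x + y).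
Proof.
move=> lphi; rewrite /ball_average lebesgue_eball Rintegral_eball//.
by under eq_Rintegral do rewrite addrC.
Qed.

(** Nodes and weights depend only on the ball around 0, so a single combination of translates
    approximates the averages at all points simultaneously. *)
Lemma ball_average_riemann phi (C : set (V -> R)) (e r : R) :
  Cc_infty phi -> convex_fset C -> (forall y, C (fun x => phi (x + y))) ->
  0 < e -> 0 < r ->
  exists2 v, C v & forall x, `|v x - ball_average phi x r| <= e.
Proof.
move=> cphi convC Cphi e0 r0.
have [L L0 HL] := Cc_infty_lipschitz cphi.
have L1 : 0 < L + 1 by rewrite ltr_wpDl.
pose d := e / (L + 1).
have d0 : 0 < d by rewrite divr_gt0.
have mod x y y' : `|y - y'| <= d -> `|phi (x + y) - phi (x + y')| <= e.
  move=> yd; have := HL (x + y') (y - y'); rewrite -addrA [y' + _]addrC subrK => H.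
  rewrite (le_trans H)// (@le_trans _ _ ((L + 1) * d))//.
    by rewrite ler_pM// lerDl.
  by rewrite /d mulrC divfK// gt_eqF.
have : cover_compact (@cball R n r) by rewrite -compact_cover; exact: cball_compact.
move=> /(_ V setT (fun c => ball c d)) [c _|y _|D _ cov].
- exact: ball_open.
- by exists y => //; exact: ballxx.
have [|v Cv Hv] := riemann_sum cphi convC Cphi (ltW e0) mod (measurable_eball 0 r)
   (lebesgue_eball_lty 0 r) (s := finmap.enum_fset D).
  move=> y yr; have /cov[c cD yc] : cball r y.
    by rewrite /cball /=; have := @eball_sub_cball 0 r y yr; rewrite /cball /= normr0 add0r.
  by exists c => //; move: yc; rewrite -ball_normE /= => /ltW.
exists v => // x; have m0 := eball_vol_gt0 r0.
rewrite ball_averageE; last exact: Cc_infty_locally_integrable.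
have := Hv x; rewrite -/(eball_vol r); set I := Rintegral _ _ _.
have -> : v x * eball_vol r - I = (v x - (eball_vol r)^-1 * I) * eball_vol r.
  by field; rewrite gt_eqF.
by rewrite normrM (gtr0_norm m0) ler_pM2r.
Qed.

Lemma ball_average_close p (r h : R) : 1 <= p -> 0 < r -> 0 < h ->
  exists2 eps, 0 < eps & forall f phi, locally_integrable_rV f ->
    locally_integrable_rV phi -> (sobolev_norm p (f \- phi)%R < eps%:E)%E ->
    forall x, `|ball_average f x r - ball_average phi x r| <= h.
Proof.
move=> p1 r0 h0; have p0 : 0 < p := lt_le_trans ltr01 p1.
have m0 := eball_vol_gt0 r0; set m := eball_vol r in m0.
pose k := h / 2; have k0 : 0 < k by rewrite divr_gt0.
(* Chosen so that k^(1 - p) times the p-th power of this bound is [k * m]: together with the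
   integral [k * m] of the constant [k] it gives [h * m], as [k] is half of [h]. *)
exists (k * m `^ p^-1); first by rewrite mulr_gt0// powR_gt0.
move=> f phi lf lphi nfp x.
pose g y := f y - phi y.
have lg : locally_integrable_rV g by exact: locally_integrableB.
have mg : measurable_fun setT g by case: lg.
have me := measurable_eball x r.
have ig := integrable_eball x r lg.
rewrite /ball_average -mulrBr -RintegralB//; [|exact: integrable_eball|exact: integrable_eball].
rewrite eball_volE /= normrM ger0_norm ?invr_ge0 ?(ltW m0)// mulrC ler_pdivrMr//.
rewrite (le_trans (le_normr_Rintegral me ig))//.
rewrite -lee_fin fineK; last first.
  by apply: integrable_fin_num => //; exact: (integrable_norm ig).
have mgp : measurable_fun setT (fun y => (`|g y| `^ p)%:E) by exact: measurable_norm_powR.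
(* [|g| <= k + k^(1 - p) |g|^p] plays the role of Hoelder's inequality, uniformly in p. *)
apply: (@le_trans _ _ (\int[mu]_(y in eball x r) (k%:E + (k `^ (1 - p))%:E * (`|g y| `^ p)%:E))%E).
  apply: ge0_le_integral => //.
  - by apply/measurable_EFinP/measurable_funTS/measurableT_comp.
  - apply: emeasurable_funD => //; apply: measurable_funTS.
    by apply: emeasurable_funM.
  - move=> y _; rewrite -EFinM -EFinD lee_fin.
    have [gk|kg] := leP `|g y| k.
      by rewrite (le_trans gk)// lerDl mulr_ge0// powR_ge0.
    have g0 : 0 < `|g y| := lt_trans k0 kg.
    rewrite (@le_trans _ _ (k `^ (1 - p) * `|g y| `^ p))//; last by rewrite lerDr ltW.
    have kk : k `^ (1 - p) * k `^ (p - 1) = 1.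
      rewrite -powRD; last by apply/implyP => _; rewrite gt_eqF.
      by rewrite (_ : 1 - p + (p - 1) = 0) ?powRr0//; ring.
    have gg : `|g y| `^ p = `|g y| `^ (p - 1) * `|g y|.
      rewrite -{3}(powRr1 (ltW g0)) -powRD ?subrK//.
      by apply/implyP => _; rewrite gt_eqF.
    rewrite gg mulrA ler_peMl ?(ltW g0)// -[leLHS]kk ler_wpM2l ?powR_ge0//.
    by rewrite ge0_ler_powR ?nnegrE ?subr_ge0 ?(ltW k0) ?(ltW kg).
have I0 := integral_norm_powR_ge0 p g.
have IE : (\int[mu]_y (`|g y| `^ p)%:E <= ((k * m `^ p^-1) `^ p)%:E)%E.
  set I := (\int[mu]_y _)%E in I0 *.
  have -> : I = ((I `^ p^-1) `^ p)%E.
    by rewrite -poweRrM mulVf ?gt_eqF// poweRe1.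
  rewrite -poweR_EFin lee_poweR ?poweR_ge0 ?(ltW p0)//.
  rewrite /I -mnormE (le_trans _ (ltW nfp))// /sobolev_norm leeDl// Lnorm_ge0//.
have mkgp : measurable_fun (eball x r) (fun y => ((k `^ (1 - p))%:E * (`|g y| `^ p)%:E)%E).
  by apply: measurable_funTS; apply: emeasurable_funM.
rewrite ge0_integralD//; [|by move=> y _; rewrite lee_fin ltW
  |by move=> y _; rewrite -EFinM lee_fin mulr_ge0// powR_ge0].
have -> : (\int[mu]_(_ in eball x r) k%:E = (k * m)%:E)%E.
  by rewrite integral_cst// EFinM; exact: (congr1 (fun z => k%:E * z)%E (eball_volE x r)).
rewrite ge0_integralZl//; [|exact: measurable_funTS
  |by rewrite lee_fin powR_ge0].
have IS : (\int[mu]_(y in eball x r) (`|g y| `^ p)%:E <= \int[mu]_y (`|g y| `^ p)%:E)%E.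
  by apply: ge0_subset_integral => //; move=> y _; rewrite lee_fin powR_ge0.
have := le_trans IS IE => /(lee_wpmul2l (x := (k `^ (1 - p))%:E)).
rewrite lee_fin powR_ge0 => /(_ isT); rewrite -EFinM => H.
rewrite (le_trans (leeD2l _ H))// -EFinD lee_fin.
rewrite powRM ?powR_ge0 ?(ltW k0)// -powRrM mulVf ?gt_eqF// powRr1 ?(ltW m0)//.
rewrite mulrA -powRD ?subrK ?powRr1 ?(ltW k0)//; last first.
  by apply/implyP => _; rewrite gt_eqF.
have hk : h = k + k by rewrite /k; field.
by rewrite {1}hk mulrDl lexx.
Qed.

Lemma precise_continuous f : locally_integrable_rV f -> continuous f ->
  precise f = f.
Proof.
move=> lf cf; apply/funext => x.
suff H : ball_average f x r @[r --> 0^'+] --> f x.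
  rewrite /precise; case: asboolP => [_|[]]; first exact: cvg_lim H.
  by apply/cvg_ex; exists (f x).
apply/cvgrPdist_le => /= e e0.
have /cvgrPdist_le/(_ e e0) /nbhs_ballP[d /= d0 fd] := cf x.
near=> r.
have r0 : 0 < r by near: r; exact: nbhs_right_gt.
have rd : r < d by near: r; exact: nbhs_right_lt.
have m0 := eball_vol_gt0 r0.
have me := measurable_eball x r.
have ic k : mu.-integrable (eball x r) (EFin \o cst k).
  apply: measurable_bounded_integrable => //; first exact: lebesgue_eball_lty.
  exists `|k|; split; first exact: num_real.
  by move=> s ks y _; exact: ltW ks.
have if_ := integrable_eball x r lf.
have -> : f x - ball_average f x r =
    (eball_vol r)^-1 * \int[mu]_(y in eball x r) (f x - f y).
  rewrite RintegralB//; last exact: ic.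
  rewrite Rintegral_cst// /ball_average.
  rewrite (_ : fine _ = eball_vol r); last exact: (congr1 fine (eball_volE x r)).
  set I := Rintegral _ _ _.
  by field; rewrite gt_eqF.
have iB : mu.-integrable (eball x r) (EFin \o (fun y => f x - f y)).
  exact: (integrableB me (ic _) if_).
rewrite normrM ger0_norm ?invr_ge0 ?(ltW m0)// mulrC ler_pdivrMr//.
rewrite (le_trans (le_normr_Rintegral me iB))//.
have -> : e * eball_vol r = \int[mu]_(y in eball x r) e.
  rewrite Rintegral_cst//.
  by rewrite (_ : fine _ = eball_vol r)//; exact: (congr1 fine (eball_volE x r)).
apply: le_Rintegral => //; [exact: (integrable_norm iB)|exact: ic|].
move=> y; rewrite /eball /= => yx; apply: fd; rewrite -ball_normE /=.
by rewrite distrC (le_lt_trans (norm_le_enorm _))// (lt_trans yx).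
Unshelve. all: by end_near. Qed.

End averages.

(** * Approximation of E(K) by F(K) *)

Section approximation.
Context {R : realType} {n : nat}.
Variables (p tau : R).
Hypotheses (p1 : 1 <= p) (tau1 : -1 <= tau <= 1).
Local Notation V := 'rV[R]_n.
Local Notation mu := (@lebesgue_rV R n).
Local Notation e_ i := (delta_mx ord0 i : V).
Local Notation N := (Nphi p tau).
Implicit Types (f g phi : V -> R) (K : set V).

Let p0 : 0 < p. Proof. exact: lt_le_trans ltr01 p1. Qed.

Lemma mnorm_bounded_support f (M B : R) : measurable_fun setT f ->
  (forall x, `|f x| <= B) -> (forall x, M < `|x| -> f x = 0) -> (mnorm p f < +oo)%E.
Proof.
move=> mf fB f0; rewrite mnormE poweR_lty//.
have : mu.-integrable setT (EFin \o (fun x => `|f x| `^ p)).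
  apply: (@integrable_bounded_support _ _ _ M (B `^ p)).
  - by apply/measurable_EFinP; exact: measurable_norm_powR.
  - move=> x; rewrite ger0_norm ?powR_ge0// ge0_ler_powR ?nnegrE ?(ltW p0)//.
    exact: le_trans (fB x).
  - by move=> x /f0 ->; rewrite normr0 powR0// gt_eqF.
move=> /integrableP[_]; apply: le_lt_trans.
rewrite le_eqVlt; apply/orP; left; apply/eqP; apply: eq_integral => x _.
by rewrite gee0_abs// lee_fin powR_ge0.
Qed.

Lemma mnorm_weak_gradient f : Cc_infty f ->
  mnorm p (enorm \o weak_gradient f) = mnorm p (enorm \o grad f).
Proof.
move=> cf; have wf := Cc_infty_weak_gradient cf.
apply: mnorm_ae.
- by apply: measurable_enorm_field; apply: mfield_weak_gradient; exists (grad f).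
- by apply: measurable_enorm_field; exact: mfield_grad.
- by apply: filterS (weak_gradient_ae wf) => x /= ->.
Qed.

Lemma Cc_infty_sobolev f : Cc_infty f -> sobolev p f.
Proof.
move=> cf; split; first exact: Cc_infty_measurable.
  by exists (grad f); exact: Cc_infty_weak_gradient.
have [B B0 fB] := Cc_infty_bounded cf; have /Cc_inftyP[_ [M fM]] := cf.
apply: lte_add_pinfty.
  exact: (mnorm_bounded_support (Cc_infty_measurable cf) fB fM).
rewrite -/(mnorm _ _) mnorm_weak_gradient//.
have /choice[Bd HB] i : exists b, forall x, `|'D_(e_ i) f x| <= b.
  by have [b _ H] := Cc_infty_bounded (Cc_infty_partial i cf); exists b.
have /choice[Md HM] i : exists M, forall x, M < `|x| -> 'D_(e_ i) f x = 0.
  by have /Cc_inftyP[_] := Cc_infty_partial i cf.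
apply: (@mnorm_bounded_support _ (\big[Num.max/0]_i Md i) (Num.sqrt (\sum_(i < n) Bd i ^+ 2))).
- by apply: measurable_enorm_field; exact: mfield_grad.
- move=> x; rewrite ger0_norm ?enorm_ge0// ler_wsqrtr//; apply: ler_sum => i _.
  rewrite mxE -expr2 -(real_normK (num_real _)) lerXn2r ?nnegrE//.
  exact: le_trans (HB i x).
- move=> x Mx; rewrite /= /enorm /dotp big1 ?sqrtr0// => i _.
  by rewrite mxE (HM i) ?mul0r// (le_lt_trans _ Mx)// (le_bigmax _ _ i).
Qed.

Lemma Cc_infty_sobolev0 f : Cc_infty f -> sobolev0 p f.
Proof.
move=> cf; split; first exact: Cc_infty_sobolev.
move=> eps eps0; exists f => //.
have -> : f \- f = cst 0 by apply/funext => x /=; rewrite subrr.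
have c0 : Cc_infty (cst 0 : V -> R) by exact: Cc_infty0.
have z : mnorm p (cst 0 : V -> R) = 0%E.
  by apply: (@Lnorm0 _ _ _ mu p%:E); rewrite eqe gt_eqF.
rewrite /sobolev_norm -/(mnorm p (cst 0)) z add0e -/(mnorm p _) mnorm_weak_gradient//.
rewrite (_ : enorm \o _ = cst 0) ?z ?lte_fin//; apply/funext => x /=.
rewrite /enorm /dotp big1 ?sqrtr0// => i _.
by rewrite mxE derive_cst mulr0.
Qed.

Lemma precise_ge1_near f x (d : R) : 1 <= precise f x -> 0 < d ->
  \forall k \near \oo, 1 - d < ball_average f x k.+1%:R^-1.
Proof.
(* Where the averages have no limit, [precise] takes the default value 0, which the hypothesis
   excludes. *)
rewrite /precise; case: asboolP => [cf l1 d0|_]; last by rewrite ler10.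
have := cf => /(cvg_at_rightP _ _ _).1 H.
have {}H : ball_average f x k.+1%:R^-1 @[k --> \oo] --> lim (ball_average f x r @[r --> 0^'+]).
  by apply: H; split; [move=> k; rewrite invr_gt0|exact: cvg_harmonic].
by apply: (cvgr_gt _ H); rewrite (lt_le_trans _ l1)// ltrBlDr ltrDl.
Qed.

(** The bound depends on the direction because the energy of the result is to be compared with that
    of [f] direction by direction. *)
Definition Nphi_le (b : V -> \bar R) : set (V -> R) :=
  [set v | Cc_infty v /\ forall u, enorm u = 1 -> (N (grad v) u <= b u)%E].

Lemma Nphi_le_convex b : (forall u, 0 <= b u)%E -> convex_fset (Nphi_le b).
Proof.
move=> b0 f g t [cf fb] [cg gb] t01; split.
  exact: (Cc_inftyD (Cc_inftyZ t cf) (Cc_inftyZ (1 - t) cg)).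
move=> u u1; have /andP[t0 t1] := t01.
apply: (le_trans (Nphi_convex tau p1 u cf cg t01)).
have -> : b u = (t%:E * b u + (1 - t)%:E * b u)%E.
  by rewrite -ge0_muleDl ?lee_fin ?subr_ge0// -EFinD addrC subrK mul1e.
apply: leeD; apply: lee_wpmul2l.
- by rewrite lee_fin.
- exact: fb.
- by rewrite lee_fin subr_ge0.
- exact: gb.
Qed.

(** One test function is chosen close enough to [f] for both purposes: [eps] controls the averages
    of this radius at every point, [e] the seminorms. Translations preserve the seminorm bound and
    convex combinations respect it. *)
Lemma ball_average_approx f (e : R) (k : nat) : sobolev0 p f -> 0 < e ->
  exists2 v, Nphi_le (fun u => N (weak_gradient f) u + e%:E)%E v &
    forall x, `|v x - ball_average f x k.+1%:R^-1| <= k.+1%:R^-1.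
Proof.
move=> [sf happ] e0; set r : R := k.+1%:R^-1.
have r0 : 0 < r by rewrite invr_gt0.
have r20 : 0 < r / 2 by rewrite divr_gt0.
have lf : locally_integrable_rV f by have [_ [g []]] := sf.
have [eps eps0 Heps] := @ball_average_close R n p r (r / 2) p1 r0 r20.
have [|phi cphi fphi] := happ (Num.min eps e); first by rewrite lt_min eps0.
have lphi := Cc_infty_locally_integrable cphi.
pose b u := (N (weak_gradient f) u + e%:E)%E.
have b0 u : (0 <= b u)%E by rewrite adde_ge0 ?Nphi_ge0// lee_fin ltW.
have Cphi y : Nphi_le b (fun x => phi (x + y)).
  split; first exact: Cc_infty_shift.
  move=> u u1; rewrite Nphi_shift//; apply: (Nphi_approx p1 tau1 sf cphi) => //.
  by apply: lt_le_trans fphi _; rewrite lee_fin ge_min lexx orbT.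
have [v bv Hv] := ball_average_riemann cphi (Nphi_le_convex b0) Cphi r20 r0.
exists v => // x.
have h1 := Hv x.
have h2 : `|ball_average f x r - ball_average phi x r| <= r / 2.
  by apply: Heps => //; apply: lt_le_trans fphi _; rewrite lee_fin ge_min lexx.
rewrite distrC in h2.
have -> : v x - ball_average f x r = (v x - ball_average phi x r) +
  (ball_average phi x r - ball_average f x r) by ring.
by rewrite (le_trans (ler_normD _ _))//; lra.
Qed.

Lemma calE_calF_approx K f (e : R) : compact K -> calE p K f -> 0 < e <= 1 ->
  exists2 g, calF p K g & forall u, enorm u = 1 ->
    (N (weak_gradient g) u <= (1 + e)%:E * (N (weak_gradient f) u + e%:E))%E.
Proof.
move=> cK [sf0 fK] /andP[e0 e1].
(* The ramp is applied twice, and its slope bound [c] then satisfies [c * c <= 1 + e]. *)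
pose d := e / 8.
have d0 : 0 < d by rewrite divr_gt0.
have d12 : 0 < d < 2^-1 by rewrite d0 /= /d; lra.
have [T [sT T0 T1 T01 T']] := smooth_ramp d12.
have T00 : T 0 = 0 by exact: T0.
pose c := (1 - 2 * d)^-1.
have dpos : 0 < 1 - 2 * d by rewrite /d; lra.
have c0 : 0 < c by rewrite invr_gt0.
have c2 : c * c <= 1 + e.
  rewrite -invfM -[leLHS]mul1r ler_pdivrMr ?mulr_gt0// /d; nra.
pose b u := (N (weak_gradient f) u + e%:E)%E.
have b0 u : (0 <= b u)%E by rewrite adde_ge0 ?Nphi_ge0// lee_fin ltW.
pose cb u := (c%:E * b u)%E.
have cb0 u : (0 <= cb u)%E by rewrite mule_ge0// lee_fin ltW.
have comp b' v : Nphi_le b' v -> Nphi_le (fun u => c%:E * b' u)%E (T \o v).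
  move=> [cv vb]; split; first exact: Cc_infty_comp.
  move=> u u1; apply: (le_trans (Nphi_comp tau p1 u cv sT T00 T')).
  by rewrite lee_wpmul2l ?lee_fin ?(ltW c0)// vb.
have /choice[v Hv] k : exists v, Nphi_le b v /\
    forall x, `|v x - ball_average f x k.+1%:R^-1| <= k.+1%:R^-1.
  by have [v bv Hv] := ball_average_approx k sf0 e0; exists v.
pose w k := T \o v k.
(* Averages above [1 - d / 2] and an error below [d / 2] put [v k x] above [1 - d], where the ramp
   is exactly 1. *)
have w1 x : K x -> \forall k \near \oo, w k x = 1.
  move=> Kx; have f1 : 1 <= precise f x.
    by have := fK x; rewrite indicE mem_set.
  have d20 : 0 < d / 2 by rewrite divr_gt0.
  near=> k; apply: T1; have [_ /(_ x)] := Hv k; rewrite ler_norml => /andP[h _].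
  have h1 : 1 - d / 2 < ball_average f x k.+1%:R^-1.
    by near: k; exact: precise_ge1_near.
  have h2 : k.+1%:R^-1 < d / 2.
    by near: k; exact: (near_infty_natSinv_lt (PosNum d20)).
  move: h h1 h2; move: (ball_average f x k.+1%:R^-1) => a.
  move: (k.+1%:R^-1) => s; lra.
(* The last condition replaces membership in the convex hull of the [w k] with [m <= k]: it survives
   convex combinations and forces the value 1 at each point of K once [m] is large. *)
pose D m : set (V -> R) := [set h | [/\ Nphi_le cb h, forall x, 0 <= h x <= 1 &
  forall x, (forall k, (m <= k)%N -> w k x = 1) -> h x = 1]].
(* Passing to [1 - h] brings the family into the form of [convex_seq_small], where values tend to
   0. *)
pose C m : set (V -> R) := [set h | D m (fun x => 1 - h x)].
have Dw m : D m (w m).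
  split; [by apply: comp; have [] := Hv m|by move=> x; exact: T01|].
  by move=> x; exact.
have [h [Dh h01 _] hK] : exists2 h, C 0%N h & forall x, K x -> h x <= d / 2.
  apply: (@convex_seq_small _ _ K C) => //; last by rewrite divr_gt0.
  - move=> m h1 h2 t [Dh1 h1_01 h1_1] [Dh2 h2_01 h2_1] /[dup] t01 /andP[t0 t1].
    rewrite /C /D /= (_ : (fun x => 1 - _) =
      (fun x => t * (1 - h1 x) + (1 - t) * (1 - h2 x))); last first.
      by apply/funext => x; ring.
    split; first exact: (Nphi_le_convex cb0 Dh1 Dh2).
      move=> x; have := h1_01 x; have := h2_01 x.
      by move=> /andP[? ?] /andP[? ?]; apply/andP; split; nra.
    move=> x Hx; have := h1_1 x Hx; have := h2_1 x Hx => /= E2 E1.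
    have -> : h1 x = 0 by lra.
    have -> : h2 x = 0 by lra.
    by ring.
  - move=> m h [Dh h01 h1]; split => // x Hx; apply: h1 => k mk.
    by apply: Hx; exact: ltnW.
  - move=> m; exists (fun x => 1 - w m x); rewrite /C /=.
    rewrite (_ : (fun x => 1 - _) = w m); first exact: Dw.
    by apply/funext => x; rewrite opprB addrC subrK.
  - move=> m h [[/Cc_infty_continuous ch _] _ _] x.
    rewrite (_ : h = (fun x => 1 - (1 - h x))); last first.
      by apply/funext => y; rewrite opprB addrC subrK.
    by apply: (@continuousB _ R^o _ (cst 1) (fun x => 1 - h x)); [exact: cst_continuous|exact: ch].
  - by move=> m h x [_ /(_ x)/andP[? ?] _]; apply/andP; split; lra.
  - move=> x a Kx a0; have [m _ Hm] := w1 x Kx; exists m => h [_ _ /(_ x Hm) h1].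
    lra.
pose h' x := 1 - h x.
have ch' : continuous h' by have [/Cc_infty_continuous] := Dh.
pose g := T \o h'.
have [cg gb] := comp _ _ Dh.
have gE : precise g = g.
  by apply: precise_continuous; [exact: Cc_infty_locally_integrable|exact: Cc_infty_continuous].
exists g.
  split; first exact: Cc_infty_sobolev0.
    by move=> x; rewrite gE; exact: T01.
  (* On K the value of [h'] is at least [1 - d / 2], so the strict inequality defines an open
     neighborhood of K. *)
  exists [set x | 1 - d < h' x]; split.
  - apply: (@open_comp _ _ h' [set r | 1 - d < r]); last exact: open_gt.
    by move=> x _; exact: ch'.
  - by move=> x Kx; rewrite /= /h'; have := hK x Kx; lra.
  - by move=> x /= hx; rewrite gE; apply: T1; exact: ltW.
move=> u u1; rewrite Nphi_weak_gradient//; apply: (le_trans (gb u u1)).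
by rewrite /cb muleA -EFinM lee_wpmul2r// lee_fin.
Unshelve. all: by end_near. Qed.

End approximation.

(** * Equality of the two infima and upper semicontinuity *)

Theorem theorem3p1 (R : realType) (n : nat) (p tau : R) (K : set 'rV[R]_n)
    (hp : 1 <= p < n%:R) (htau : -1 <= tau <= 1) (hK : compact K) :
  capacity p tau K = ereal_inf [set energy p tau f | f in calF p K] /\
  (forall eps : R, 0 < eps ->
     exists O : set 'rV[R]_n, [/\ open O, K `<=` O &
       forall F : set 'rV[R]_n, compact F -> K `<=` F -> F `<=` O ->
         (capacity p tau F <= capacity p tau K + eps%:E)%E]).
Proof.
have /andP[p1 pn] := hp.
have calFE A f : calF p A f -> calE p A f.
  move=> [sf f01 [U [_ AU f1]]]; split=> // x; rewrite indicE.
  case: (pselect (A x)) => [Ax|nAx]; first by rewrite mem_set// f1//; exact: AU.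
  by rewrite memNset//; have /andP[] := f01 x.
have capE : capacity p tau K = ereal_inf [set energy p tau f | f in calF p K].
  apply/eqP; rewrite eq_le; apply/andP; split.
    by apply: le_ereal_inf => _ [f /calFE Ef <-]; exists f.
  apply: le_ereal_inf_tmp => _ [f Ef <-].
  (* Infinite energy is set aside, as [energy_limit] works with the real number obtained by adding
     [eps] to the energy. *)
  have [->|foo] := eqVneq (energy p tau f) +oo%E; first by rewrite leey.
  have sf : sobolev p f by have [[]] := Ef.
  have /choice[g gP] m : exists g, calF p K g /\ forall u, enorm u = 1 ->
      (Nphi p tau (weak_gradient g) u <=
       (1 + m.+1%:R^-1)%:E * (Nphi p tau (weak_gradient f) u + m.+1%:R^-1%:E))%E.
    have m01 : 0 < (m.+1%:R^-1 : R) <= 1.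
      apply/andP; split; first by rewrite invr_gt0 ltr0n.
      by rewrite -[leRHS]invr1 lef_pV2 ?posrE ?ler1n.
    by have [g Fg Hg] := calE_calF_approx p1 htau hK Ef m01; exists g.
  have fltoo : (energy p tau f < +oo)%E by rewrite ltey.
  apply/lee_addgt0Pr => eps eps0.
  have [m gm] := energy_limit p1 pn htau sf (fun m => (gP m).2)
    fltoo eps0.
  apply: le_trans gm; apply: ereal_inf_lbound; exists (g m) => //.
  by have [] := gP m.
split=> // eps eps0.
have [Koo|Kfin] := eqVneq (capacity p tau K) +oo%E.
  exists setT; split=> //; first exact: openT.
  by move=> F _ _ _; rewrite Koo addye// leey.
have Kge0 : (0 <= capacity p tau K)%E.
  by apply: le_ereal_inf_tmp => _ [f _ <-]; exact: energy_ge0.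
have Kf : capacity p tau K \is a fin_num by rewrite ge0_fin_numE// ltey.
have [|_ [f Ff <-] fK] := @lb_ereal_inf_adherent _ [set energy p tau f | f in calF p K] _ eps0.
  by rewrite -capE.
have [sf f01 [U [oU KU f1]]] := Ff.
exists U; split=> // F _ _ FU.
apply: (@le_trans _ _ (energy p tau f)).
  apply: ereal_inf_lbound; exists f => //; apply: calFE.
  by split=> //; exists U.
by rewrite capE ltW.
Qed.
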